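(* Let $f\in C^\infty(\mathbb{R})$ be a smooth function with $\int f=0$ and $|x|f\in L^1(\mathbb{R})$. Then there is a constant $c_f$ (depending only on $f$) such that for every $u\in BV(\mathbb{R})$, $$\lim_{r\to0^+}\frac1r\|f_r*u\|_{L^2}^2=c_f\sum_{x\in J_u}|u^+(x)-u^-(x)|^2 .$$
   Context: $f_r(x)=r^{-1}f(x/r)$. $J_u$ is the jump set of $u$ and $u^\pm(x)$ are the one-sided limits of $u$ at $x\in J_u$. *)

(* Defs.v *)
From HB Require Import structures.
From mathcomp Require Import all_boot all_order all_algebra.
From mathcomp Require Import all_classical all_reals all_analysis.
Set Implicit Arguments.
Unset Strict Implicit.
Unset Printing Implicit Defensive.
Import Order.TTheory GRing.Theory Num.Theory.
Import numFieldNormedType.Exports.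
Local Open Scope classical_set_scope.
Local Open Scope ring_scope.

Definition smooth (R : realType) (f : R -> R) : Prop :=
  forall (n : nat) (x : R), derivable (derive1n n f) x 1.

Definition test_function (R : realType) (phi : R -> R) : Prop :=
  smooth phi /\ compact (closure [set x | phi x != 0]).

(* Integral against a finite signed measure; it does not depend on the chosen
   Hahn decomposition. *)
Definition charge_integral (R : realType)
    (nu : {charge set (measurableTypeR R) -> \bar R})
    (P N : set (measurableTypeR R)) (nuPN : hahn_decomposition nu P N)
    (phi : R -> R) : R :=
  Rintegral (jordan_pos nuPN) setT phi - Rintegral (jordan_neg nuPN) setT phi.

Definition distributional_derivative (R : realType) (u : R -> R)
    (nu : {charge set (measurableTypeR R) -> \bar R}) : Prop :=
  forall (P N : set (measurableTypeR R)) (nuPN : hahn_decomposition nu P N)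
    (phi : R -> R), test_function phi ->
  Rintegral lebesgue_measure setT (fun x => u x * derive1 phi x)
    = - charge_integral nuPN phi.

(* BV(R): integrable functions whose distributional derivative is a finite
   signed Radon measure (a charge is finite, and every finite Borel measure on
   the line is Radon). This is invariant under modification of u on a null set,
   so it is not the pointwise notion [bounded_variation]. *)
Definition BV_line (R : realType) (u : R -> R) : Prop :=
  lebesgue_measure.-integrable setT (EFin \o u) /\
  exists nu : {charge set (measurableTypeR R) -> \bar R},
    distributional_derivative u nu.

(* One-sided limits are taken in the approximate (L^1-average) sense, since
   elements of BV(R) are only defined up to null sets. *)
Definition right_limit (R : realType) (u : R -> R) (x a : R) : Prop :=
  iavg (fun y => u y - a) `]x, x + h[ @[h --> 0^'+] --> 0%E.

Definition left_limit (R : realType) (u : R -> R) (x a : R) : Prop :=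
  iavg (fun y => u y - a) `]x - h, x[ @[h --> 0^'+] --> 0%E.

Definition jump_set (R : realType) (u : R -> R) : set R :=
  [set x | exists a b : R, [/\ right_limit u x a, left_limit u x b & a <> b]].

(* Approximate limits are unique, so [get] returns the limit when it exists. *)
Definition uplus (R : realType) (u : R -> R) (x : R) : R :=
  get [set a | right_limit u x a].

Definition uminus (R : realType) (u : R -> R) (x : R) : R :=
  get [set a | left_limit u x a].

Definition dilation (R : realType) (f : R -> R) (r x : R) : R :=
  r^-1 * f (x / r).

Definition convolution (R : realType) (g u : R -> R) (x : R) : R :=
  Rintegral lebesgue_measure setT (fun y => g (x - y) * u y).

(* Main.v *)
(** Let [nu] be the derivative of [u]; then [u y = k + nu ]-oo, y]] for a.e. [y],
    as one sees by testing [nu] against smooth approximations of the indicator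
    of [ ]a, b] ], for Lebesgue points [a < b] of [u].  Let [F] be the
    antiderivative of [f] vanishing at infinity: the moment condition and
    [int f = 0] make [F] bounded, integrable and [O(1/|x|)].  By Fubini,
    [f_r * u (x) = int F((x - t) / r) dnu(t)], so that with [w_r := f_r * u]
      [r^-1 ||w_r||^2 = int (int w_r(r z + t) F(z) dz) dnu(t)].
    As [r -> 0+], the decay of [F] leaves in [w_r(r z + t)] only the atom of [nu]
    at [t], that is [w_r(r z + t) -> F(z) nu{t}], and three applications of
    dominated convergence give the limit [(int F^2) (sum_t nu{t}^2)]; finally
    [nu{t}] is the jump of [u] at [t]. *)
Require Import Defs.
From HB Require Import structures.
From mathcomp Require Import all_boot all_order all_algebra.
From mathcomp Require Import finmap.
From mathcomp Require Import all_classical all_reals all_analysis.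
From mathcomp Require Import measurable_realfun ring lra.
Set Implicit Arguments.
Unset Strict Implicit.
Unset Printing Implicit Defensive.
Import Order.TTheory GRing.Theory Num.Theory.
Import numFieldNormedType.Exports.
Local Open Scope classical_set_scope.
Local Open Scope ring_scope.

(** * A smooth step function *)

Section smooth_step.
Context {R : realType}.
Implicit Types (f g : R -> R) (a b x y : R).

(** Fubini and dominated convergence are applied to positive measures, so the proof runs with the
    two Jordan parts [p] and [n] of [nu], and w_r is a difference of two potentials. In the square
    w_r * w_r only one factor is expanded into potentials. The other is kept as a function: it is
    bounded, uniformly in r, by sup |F| times the total mass of [p] and [n], and this bound supplies
    the dominating functions once the potentials themselves have converged. The limit then has four
    terms; the mixed ones, such as the integral of n{t} against [p], vanish because mutually
    singular measures share no atom. The other two become sums because a finite measure has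
    countably many atoms. The limit r -> 0+ is taken along arbitrary positive sequences tending to
    0, the setting of dominated convergence. Since [u] is known only up to null sets, its one-sided
    limits are computed on the representative k + [cdf p] - [cdf n], which has them at every point;
    the constant k disappears from the convolution because [f] has mean 0. *)

Definition diff_upto n f : Prop :=
  forall k x, (k <= n)%N -> derivable (derive1n k f) x 1.

(** Closure under products and inverses needs an induction on the order of differentiability: the
    derivative of a product involves the factors themselves, known to one order more than their
    derivatives. Hence the finite classes [diff_upto n], with [diff_uptoS] as induction step and
    [diff_uptoW] to lower the order. *)
Lemma smoothE f : smooth f <-> forall n, diff_upto n f.
Proof.
split=> [sf n k x _|df n x]; first exact: sf.
exact: (df n n x (leqnn n)).
Qed.

Lemma derive1nSr n f : derive1n n.+1 f = derive1n n (derive1 f).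
Proof. by rewrite /derive1n iterSr. Qed.

Lemma diff_uptoS n f : diff_upto n.+1 f <->
  (forall x, derivable f x 1) /\ diff_upto n (derive1 f).
Proof.
split=> [df|[d0 df] [|k] x]; last 2 first.
- by move=> _; exact: d0.
- by rewrite ltnS derive1nSr; exact: df.
split=> [x|k x kn]; first exact: (df 0%N x isT).
by rewrite -derive1nSr; apply: df.
Qed.

Lemma diff_upto0 f : diff_upto 0 f <-> (forall x, derivable f x 1).
Proof.
split=> [df x|df [|//] x _]; last exact: df.
exact: (df 0%N x isT).
Qed.

Lemma diff_uptoW n f : diff_upto n.+1 f -> diff_upto n f.
Proof. by move=> df k x kn; apply: df; exact: leqW. Qed.

Lemma diff_uptoD n f g : diff_upto n f -> diff_upto n g ->
  diff_upto n (fun x => f x + g x).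
Proof.
elim: n f g => [|n ih] f g.
  by move=> /diff_upto0 df /diff_upto0 dg; apply/diff_upto0 => x; exact: derivableD.
move=> /diff_uptoS[df df'] /diff_uptoS[dg dg']; apply/diff_uptoS; split.
  by move=> x; exact: derivableD.
rewrite (_ : derive1 _ = fun x => derive1 f x + derive1 g x); first exact: ih.
by apply/funext => x; rewrite !derive1E deriveD.
Qed.

Lemma diff_uptoZ n a f : diff_upto n f -> diff_upto n (fun x => a * f x).
Proof.
elim: n f => [|n ih] f.
  by move=> /diff_upto0 df; apply/diff_upto0 => x; exact: derivableZ.
move=> /diff_uptoS[df df']; apply/diff_uptoS; split.
  by move=> x; exact: derivableZ.
rewrite (_ : derive1 _ = fun x => a * derive1 f x); first exact: ih.
by apply/funext => x; rewrite !derive1E (deriveZ a (df x)).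
Qed.

Lemma diff_uptoM n f g : diff_upto n f -> diff_upto n g ->
  diff_upto n (fun x => f x * g x).
Proof.
elim: n f g => [|n ih] f g.
  by move=> /diff_upto0 df /diff_upto0 dg; apply/diff_upto0 => x; exact: derivableM.
move=> /[dup] /diff_uptoW fn /diff_uptoS[df df'].
move=> /[dup] /diff_uptoW gn /diff_uptoS[dg dg']; apply/diff_uptoS; split.
  by move=> x; exact: derivableM.
rewrite (_ : derive1 _ = fun x => f x * derive1 g x + derive1 f x * g x).
  by apply: diff_uptoD; exact: ih.
apply/funext => x; rewrite !derive1E (deriveM (df x) (dg x)) /GRing.scale/=.
by rewrite (mulrC (g x)).
Qed.

Lemma diff_uptoV n f : (forall x, f x != 0) -> diff_upto n f ->
  diff_upto n (fun x => (f x)^-1).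
Proof.
move=> f0; elim: n => [|n ih].
  by move=> /diff_upto0 df; apply/diff_upto0 => x; exact: derivableV.
move=> /[dup] /diff_uptoW fn /diff_uptoS[df df']; apply/diff_uptoS; split.
  by move=> x; exact: derivableV.
rewrite (_ : derive1 _ = fun x => -1 * (((f x)^-1 * (f x)^-1) * derive1 f x)).
  by apply: diff_uptoZ; apply: diff_uptoM => //; apply: diff_uptoM; exact: ih.
apply/funext => x; rewrite !derive1E deriveV// /GRing.scale/=.
by rewrite -exprVn expr2 mulN1r mulNr.
Qed.

Lemma derive1_affine f a b : (forall x, derivable f x 1) ->
  (forall x, derivable (fun x : R => f (a * x + b)) x 1) /\
  derive1 (fun x : R => f (a * x + b)) = fun x => a * derive1 f (a * x + b).
Proof.
move=> df.
have D x : is_derive x 1 (fun x : R => f (a * x + b)) (a * derive1 f (a * x + b)).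
  have -> : (fun x : R => f (a * x + b)) = f \o (fun x => a * x + b) by [].
  rewrite mulrC derive1E; apply: is_derive1_comp; first exact: derivableP.
  have := is_deriveD (is_deriveZ a (is_derive_id x (1 : R))) (is_derive_cst b x 1).
  by rewrite addr0 /GRing.scale/= mulr1.
split=> [x|]; first by case: (D x).
by apply/funext => x; rewrite derive1E; case: (D x).
Qed.

Lemma diff_upto_affine n f a b : diff_upto n f ->
  diff_upto n (fun x : R => f (a * x + b)).
Proof.
elim: n f => [|n ih] f.
  by move=> /diff_upto0 df; apply/diff_upto0; apply: (derive1_affine _ _ df).1.
move=> /diff_uptoS[df df']; apply/diff_uptoS; split.
  exact: (derive1_affine _ _ df).1.
by rewrite (derive1_affine _ _ df).2; apply: diff_uptoZ; exact: ih.
Qed.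

Lemma smoothD f g : smooth f -> smooth g -> smooth (fun x => f x + g x).
Proof. by move=> /smoothE f_ /smoothE g_; apply/smoothE => n; exact: diff_uptoD. Qed.

Lemma smoothZ a f : smooth f -> smooth (fun x => a * f x).
Proof. by move=> /smoothE f_; apply/smoothE => n; exact: diff_uptoZ. Qed.

Lemma smooth_affine f a b : smooth f -> smooth (fun x : R => f (a * x + b)).
Proof. by move=> /smoothE f_; apply/smoothE => n; exact: diff_upto_affine. Qed.

Lemma smooth_derivable f x : smooth f -> derivable f x 1.
Proof. by move=> /(_ 0%N x). Qed.

Lemma smooth_continuous f : smooth f -> continuous f.
Proof.
by move=> sf x; apply/differentiable_continuous/derivable1_diffP/smooth_derivable.
Qed.

Lemma smooth_derive f : smooth f -> smooth (derive1 f).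
Proof. by move=> sf n x; rewrite -derive1nSr; exact: sf. Qed.

(* The span of these functions is stable under derivation, see [is_derive_flat]. *)
Definition flat n (x : R) : R := if 0 < x then x^-1 ^+ n * expR (- x^-1) else 0.

(** With y = 1/x, the exponential series gives exp y >= y^(n+2) / (n+2)!, that is y^n exp(-y) <=
    (n+2)! y^(-2). A quadratic bound is what differentiability at 0 asks for. *)
Lemma flat_le n x : `|flat n x| <= (n.+2)`!%:R * x ^+ 2.
Proof.
rewrite /flat; case: ifPn => [x0|_]; last by rewrite normr0 mulr_ge0// sqr_ge0.
rewrite ger0_norm; last by rewrite mulr_ge0// ?exprn_ge0 ?invr_ge0 ?(ltW x0)// expR_ge0.
have y0 : 0 <= x^-1 by rewrite invr_ge0 ltW.
have fpos : 0 < (n.+2)`!%:R :> R by rewrite ltr0n fact_gt0.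
have := expR_ge1Dxn n.+1 y0; rewrite expRN.
move=> h; have {}h : x^-1 ^+ n.+2 / n.+2`!%:R <= expR x^-1.
  by apply: le_trans h; rewrite lerDr.
rewrite ler_pdivrMr ?expR_gt0//.
move: h; rewrite ler_pdivrMr// => h.
have xx : x^-1 ^+ n = x^-1 ^+ n.+2 * x ^+ 2.
  by rewrite -addn2 exprD -mulrA -exprMn mulVf ?gt_eqF// expr1n mulr1.
rewrite xx [leRHS]mulrAC ler_pM2r ?exprn_gt0// mulrC.
by [].
Qed.

(** Away from 0 this is calculus. At 0, [flat_le] squeezes the difference quotient between -C|h| and
    C|h| with C = (n+2)!, so the derivative is 0. *)
Lemma is_derive_flat n x :
  is_derive x 1 (flat n) (flat n.+2 x - n%:R * flat n.+1 x).
Proof.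
have [x0|x0|->] := ltgtP x 0.
- apply: (@near_eq_is_derive _ _ _ (cst 0)).
    near=> y; rewrite /flat ltNge ltW//=.
    by near: y; exact: lt_nbhsl.
  rewrite /flat ltNge ltW//= mulr0 subr0; exact: is_derive_cst.
- apply: (@near_eq_is_derive _ _ _ (fun x => x^-1 ^+ n * expR (- x^-1))).
    near=> y; rewrite /flat ifT//.
    by near: y; exact: lt_nbhsr.
  have nx : id x != 0 by rewrite gt_eqF.
  have Dv : is_derive x 1 (fun y : R => y^-1) (- x ^- 2).
    by have := is_deriveV nx (is_derive_id x (1:R)); rewrite /GRing.scale/= mulr1.
  have De : is_derive x 1 (fun y : R => expR (- y^-1)) (expR (- x^-1) * (x ^- 2)).
    have -> : (fun y : R => expR (- y^-1)) = expR \o (fun y => - y^-1) by [].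
    apply: is_derive1_comp; have -> : (fun y : R => - y^-1) = \- (fun y => y^-1) by [].
    by apply: is_derive_eq; rewrite opprK.
  have -> : (fun x0 : R => x0^-1 ^+ n * expR (- x0^-1)) =
     ((fun y : R => y^-1) ^+ n) * (fun y : R => expR (- y^-1)).
    by apply/funext => y; rewrite fctE/=; congr (_ * _); rewrite fctE.
  rewrite /flat x0; apply: is_derive_eq.
  rewrite /GRing.scale/= !fctE /= -!exprVn.
  case: n => [|n]; first by ring.
  rewrite /= !exprS; ring.
- have -> : flat n.+2 0 - n%:R * flat n.+1 0 = 0 by rewrite /flat ltxx mulr0 subr0.
  suff h : h^-1 *: ((flat n \o shift 0) (h *: (1:R)) - flat n 0) @[h --> 0^'] -->
    (0 : R).
    by apply: DeriveDef; [apply/cvg_ex; exists 0|exact: cvg_lim].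
  pose C : R := (n.+2)`!%:R.
  have C0 : C * `|h| @[h --> (0:R)^'] --> (0 : R).
    rewrite -[X in _ --> X](mulr0 C); apply: cvgMr.
    by rewrite -[X in _ --> X](@normr0 _ R); apply: cvg_norm; exact: cvg_within.
  apply: (@squeeze_cvgr _ _ _ _ (fun h => - (C * `|h|)) (fun h => C * `|h|)) => //;
    last first.
    by rewrite -[X in _ --> X]oppr0; exact: cvgN.
  near=> h; rewrite -ler_norml /= {2}/flat ltxx subr0 addr0 /GRing.scale/= mulr1.
    have h0 : h != 0 by near: h; exact: nbhs_dnbhs_neq.
    rewrite normrM normfV ler_pdivrMl ?normr_gt0// mulrCA.
    by rewrite -expr2 real_normK ?num_real// flat_le.
Unshelve. all: by end_near. Qed.

Lemma smooth_flat n : smooth (flat n).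
Proof.
apply/smoothE => m; elim: m n => [|m ih] n.
  by apply/diff_upto0 => x; case: (is_derive_flat n x).
apply/diff_uptoS; split; first by move=> x; case: (is_derive_flat n x).
rewrite (_ : derive1 _ = fun x => flat n.+2 x + - n%:R * flat n.+1 x).
  by apply: diff_uptoD => //; exact: diff_uptoZ.
by apply/funext => x; rewrite derive1E mulNr; case: (is_derive_flat n x).
Qed.

Lemma flat_ge0 n x : 0 <= flat n x.
Proof.
rewrite /flat; case: ifPn => // x0.
by rewrite mulr_ge0 ?expR_ge0// exprn_ge0// invr_ge0 ltW.
Qed.

Lemma flat_gt0 n x : 0 < x -> 0 < flat n x.
Proof. by move=> x0; rewrite /flat x0 mulr_gt0 ?expR_gt0// exprn_gt0// invr_gt0. Qed.

Lemma flat0 n x : x <= 0 -> flat n x = 0.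
Proof. by rewrite leNgt /flat => /negbTE ->. Qed.

(** The classical smooth transition from 0 to 1. The denominator never vanishes, as x and 1 - x are
    not both nonpositive. Its derivative, of mass 1 and zero outside [0, 1], is the profile of all
    the mollifiers. *)
Definition step (x : R) : R := flat 0 x / (flat 0 x + flat 0 (1 - x)).

Let den_gt0 x : 0 < flat 0 x + flat 0 (1 - x).
Proof.
have [x0|x0] := ltP 0 x; first by rewrite ltr_wpDr ?flat_ge0 ?flat_gt0.
by rewrite ltr_wpDl ?flat_ge0 ?flat_gt0// subr_gt0 (le_lt_trans x0).
Qed.

Lemma diff_flat m n : diff_upto m (flat n).
Proof. by move: m; apply/smoothE; exact: smooth_flat. Qed.

Lemma smooth_step : smooth step.
Proof.
apply/smoothE => n; apply: diff_uptoM; first exact: diff_flat.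
apply: diff_uptoV; first by move=> x; rewrite gt_eqF.
apply: diff_uptoD; first exact: diff_flat.
rewrite (_ : (fun x => _) = fun x => flat 0 (-1 * x + 1)).
  by apply: diff_upto_affine; exact: diff_flat.
by apply/funext => x; rewrite mulN1r addrC.
Qed.

Lemma step0 x : x <= 0 -> step x = 0.
Proof. by move=> x0; rewrite /step flat0// mul0r. Qed.

Lemma step1 x : 1 <= x -> step x = 1.
Proof.
move=> x1; rewrite /step [flat 0 (1 - x)]flat0 ?subr_le0// addr0 divff// gt_eqF//.
by rewrite flat_gt0// (lt_le_trans ltr01).
Qed.

Lemma step_ge0 x : 0 <= step x.
Proof. by rewrite divr_ge0 ?flat_ge0// ltW. Qed.

Lemma step_le1 x : step x <= 1.
Proof. by rewrite ler_pdivrMr// mul1r lerDl flat_ge0. Qed.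

Lemma derive_step_out x : (x < 0) || (1 < x) -> derive1 step x = 0.
Proof.
move=> h; rewrite derive1E.
rewrite (near_eq_derive (g := cst (step x)))//; first by rewrite derive_cst.
case/orP: h => h.
  near=> y; rewrite /= [RHS]step0 ?(ltW h)// step0// ltW//.
  by near: y; exact: lt_nbhsl.
near=> y; rewrite /= [RHS]step1 ?(ltW h)// step1// ltW//.
by near: y; exact: lt_nbhsr.
Unshelve. all: by end_near. Qed.

(** The derivative is continuous on the compact [0, 1] and zero elsewhere; adding 1 to its maximum
    modulus makes the bound strictly positive. *)
Lemma derive_step_bounded : exists2 M, 0 < M & forall x, `|derive1 step x| <= M.
Proof.
have cs : {within `[0, 1], continuous (fun x : R => `|derive1 step x|)}.
  apply: continuous_subspaceT => x.
  apply: (@continuous_comp _ _ _ (derive1 step) Num.norm).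
    exact: smooth_continuous (smooth_derive smooth_step) _.
  exact: norm_continuous.
have [c _ cmax] := EVT_max ler01 cs.
exists (`|derive1 step c| + 1); first by rewrite ltr_wpDl.
move=> x; have [xo|] := boolP ((x < 0) || (1 < x)).
  by rewrite derive_step_out// normr0 addr_ge0.
rewrite negb_or -!leNgt => /andP[x0 x1].
by apply: (le_trans (cmax x _)); rewrite ?lerDl// in_itv/= x0.
Qed.

End smooth_step.

(** * Integration tools *)

Section affine_change_of_variables.
Context {R : realType}.
Local Notation mu := (@lebesgue_measure R).

Lemma measurable_affine (a b : R) : measurable_fun [set: R] (fun x : R => a * x + b).
Proof. by apply: measurable_funD => //; exact: measurable_funM. Qed.

Lemma affine_preimage_itv (a b c d : R) : 0 < `|a| ->
  mu ((fun x => a * x + b) @^-1` `]c, d]) = (`|a|^-1%:E * mu `]c, d])%E.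
Proof.
rewrite normr_gt0 => a0; have [an|ap] := ltP a 0.
- have -> : (fun x => a * x + b) @^-1` `]c, d] = `[(d - b) / a, (c - b) / a[%classic.
    apply/seteqP; split => x /=; rewrite !in_itv/= ltr_ndivlMr// ler_ndivrMr//;
    by rewrite [x * a]mulrC lerBrDr ltrBlDr andbC.
  rewrite !lebesgue_measure_itv/= !lte_fin ltr_nM2r ?invr_lt0// ltrD2r.
  case: ifPn => _; last by rewrite mule0.
  by rewrite -!EFinB -EFinM ltr0_norm// invrN -mulrBl; congr EFin; ring.
- have {}ap : 0 < a by rewrite lt_neqAle eq_sym a0.
  have -> : (fun x => a * x + b) @^-1` `]c, d] = `](c - b) / a, (d - b) / a]%classic.
    apply/seteqP; split => x /=; rewrite !in_itv/= ltr_pdivrMr// ler_pdivlMr//;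
    by rewrite [x * a]mulrC lerBrDr ltrBlDr.
  rewrite !lebesgue_measure_itv/= !lte_fin ltr_pM2r ?invr_gt0// ltrD2r.
  case: ifPn => _; last by rewrite mule0.
  by rewrite -!EFinB -EFinM gtr0_norm// -mulrBl; congr EFin; ring.
Qed.

(** Uniqueness of Lebesgue measure: |a| times the image of [mu] under x -> a x + b gives each ]c, d]
    its length. For a < 0 the preimage is half-open on the other side, with the same length. *)
Lemma lebesgue_measure_affine (a b : R) (A : set R) : a != 0 -> measurable A ->
  mu A = (`|a|%:E * mu ((fun x => a * x + b)%R @^-1` A))%E.
Proof.
move=> a0 mA.
pose phi : R -> measurableTypeR R := fun x => a * x + b.
have mphi : measurable_fun [set: R] phi by exact: measurable_affine.
pose pm := [the {measure set (measurableTypeR R) -> \bar R} of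
  measure_function_pushforward__canonical__measure_function_Measure mu mphi].
apply: (@lebesgue_measure_unique _ (mscale (NngNum (normr_ge0 a)) pm)) => //.
move=> _ [[c d] _ <-].
change (mu `]c, d]%classic =
  (`|a|%:E * mu ((fun x => a * x + b)%R @^-1` `]c, d]%classic))%E).
rewrite affine_preimage_itv ?normr_gt0//.
by rewrite muleA -EFinM divff ?normr_eq0// mul1e.
Qed.

Local Open Scope ereal_scope.

Lemma ge0_integral_affine (a b : R) (g : R -> \bar R) : a != 0%R ->
  measurable_fun [set: R] g -> (forall x, 0 <= g x) ->
  \int[mu]_x g x = `|a|%:E * \int[mu]_x g (a * x + b)%R.
Proof.
move=> a0 mg g0.
pose phi : R -> measurableTypeR R := (fun x => a * x + b)%R.
have mphi : measurable_fun [set: R] phi by exact: measurable_affine.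
pose pm := [the {measure set (measurableTypeR R) -> \bar R} of
  measure_function_pushforward__canonical__measure_function_Measure mu mphi].
transitivity (\int[mscale (NngNum (normr_ge0 a)) pm]_x g x).
  apply: eq_measure_integral => //= A mA _.
  exact: lebesgue_measure_affine.
rewrite ge0_integral_mscale//=; congr (_ * _).
exact: ge0_integral_pushforward.
Qed.

(** By the nonnegative change of variables for |g|: an infinite integral of |g(a x + b)|, multiplied
    by |a| > 0, would make that of |g| infinite. *)
Lemma integrable_affine (a b : R) (g : R -> \bar R) : a != 0%R ->
  mu.-integrable [set: R] g ->
  mu.-integrable [set: R] (fun x => g (a * x + b)%R).
Proof.
move=> a0 /integrableP[mg ig]; apply/integrableP; split.
  by apply: (measurableT_comp mg); exact: measurable_affine.
move: ig; rewrite (ge0_integral_affine b a0)//; last exact: measurableT_comp.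
have : 0 <= \int[mu]_x `|g (a * x + b)%R| by exact: integral_ge0.
case: (integral _ _ _) => [r _ _|_|//]; first by rewrite ltry.
by rewrite gt0_muley ?lte_fin ?normr_gt0.
Qed.

Lemma integral_affine (a b : R) (g : R -> \bar R) : a != 0%R ->
  mu.-integrable [set: R] g ->
  \int[mu]_x g x = `|a|%:E * \int[mu]_x g (a * x + b)%R.
Proof.
move=> a0 ig; have mg := measurable_int _ ig.
rewrite [LHS]integralE.
rewrite (ge0_integral_affine (g := g^\+) b a0)//; last exact: measurable_funepos.
rewrite (ge0_integral_affine (g := g^\-) b a0)//; last exact: measurable_funeneg.
rewrite [in RHS]integralE.
have igp := integrable_funepos measurableT (integrable_affine b a0 ig).
have ign := integrable_funeneg measurableT (integrable_affine b a0 ig).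
have fp := integrable_fin_num measurableT igp.
rewrite [RHS]muleBr//; last exact: fin_num_adde_defr.
congr (_ - _); congr (_ * _); apply: eq_integral => x _.
  by rewrite !unlock.
by rewrite !unlock.
Qed.

Local Open Scope ring_scope.

Lemma Rintegral_affine (a b : R) (g : R -> R) : a != 0 ->
  mu.-integrable [set: R] (EFin \o g) ->
  Rintegral mu setT g = `|a| * Rintegral mu setT (fun x => g (a * x + b)).
Proof.
move=> a0 ig; rewrite /Rintegral (integral_affine b a0 ig) fineM//.
by rewrite integrable_fin_num//; exact: (integrable_affine b a0 ig).
Qed.

End affine_change_of_variables.

Section real_valued_integrals.
Context {R : realType}.

Lemma dominated_Rintegral d (T : measurableType d) (m : {measure set T -> \bar R})
    (h_ : nat -> T -> R) (h G : T -> R) :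
  (forall n, measurable_fun setT (h_ n)) ->
  (forall x, h_ n x @[n --> \oo] --> h x) ->
  m.-integrable setT (EFin \o G) -> (forall n x, `|h_ n x| <= G x) ->
  m.-integrable setT (EFin \o h) /\
  Rintegral m setT (h_ n) @[n --> \oo] --> Rintegral m setT h.
Proof.
move=> mh hh iG hG.
have mE n : measurable_fun setT (EFin \o h_ n) by exact/measurable_EFinP.
have mhl : measurable_fun setT (EFin \o h).
  by apply/measurable_EFinP; apply: (measurable_fun_cvg mh) => x _; exact: hh.
have [] := @dominated_convergence _ _ _ m setT measurableT (fun n => EFin \o h_ n)
  (EFin \o h) (EFin \o G) mE mhl.
- by apply: aeW => x _; apply: cvg_EFin; [exact: nearW|exact: hh].
- exact: iG.
- by apply: aeW => x n _ /=; rewrite lee_fin.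
move=> ih _ cvgh; split=> //.
by apply: fine_cvg; rewrite fineK ?integrable_fin_num.
Qed.

Lemma integrable_of_le d (T : measurableType d) (m : {measure set T -> \bar R})
    (h G : T -> R) : measurable_fun setT h -> (forall x, `|h x| <= G x) ->
  m.-integrable setT (EFin \o G) -> m.-integrable setT (EFin \o h).
Proof.
move=> mh hG; apply: le_integrable => //; first exact/measurable_EFinP.
by move=> x _ /=; rewrite lee_fin (le_trans (hG x))// ler_norm.
Qed.

Lemma integrable_scale d (T : measurableType d) (m : {measure set T -> \bar R})
    (a : R) (h : T -> R) :
  m.-integrable setT (EFin \o h) -> m.-integrable setT (EFin \o (fun x => a * h x)).
Proof. by move=> ih; exact: (integrableZl measurableT a ih). Qed.

Lemma integrable_add d (T : measurableType d) (m : {measure set T -> \bar R})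
    (g h : T -> R) :
  m.-integrable setT (EFin \o g) -> m.-integrable setT (EFin \o h) ->
  m.-integrable setT (EFin \o (fun x => g x + h x)).
Proof. by move=> ig ih; exact: (integrableD measurableT ig ih). Qed.

Lemma integrable_sub d (T : measurableType d) (m : {measure set T -> \bar R})
    (g h : T -> R) :
  m.-integrable setT (EFin \o g) -> m.-integrable setT (EFin \o h) ->
  m.-integrable setT (EFin \o (fun x => g x - h x)).
Proof. by move=> ig ih; exact: (integrableB measurableT ig ih). Qed.

Lemma finite_integrable d (T : measurableType d)
    (m : {finite_measure set T -> \bar R}) (h : T -> R) (M : R) :
  measurable_fun setT h -> (forall x, `|h x| <= M) -> m.-integrable setT (EFin \o h).
Proof.
move=> mh hM; apply: (@integrable_of_le _ _ _ _ (cst M)) => //.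
exact: finite_measure_integrable_cst.
Qed.

(** All sections, not just almost all, are asked to be integrable: [fine] then loses nothing, and
    the real-valued inner integrals agree with [fubini_F] and [fubini_G] at every point. *)
Lemma Rintegral_fubini d1 d2 (T1 : measurableType d1) (T2 : measurableType d2)
    (m1 : {sigma_finite_measure set T1 -> \bar R})
    (m2 : {sigma_finite_measure set T2 -> \bar R}) (k : T1 * T2 -> R) :
  (m1 \x m2)%E.-integrable setT (EFin \o k) ->
  (forall x, m2.-integrable setT (EFin \o (fun y => k (x, y)))) ->
  (forall y, m1.-integrable setT (EFin \o (fun x => k (x, y)))) ->
  [/\ m1.-integrable setT (EFin \o (fun x => Rintegral m2 setT (fun y => k (x, y)))),
      measurable_fun setT (fun y => Rintegral m1 setT (fun x => k (x, y))) &
      Rintegral m1 setT (fun x => Rintegral m2 setT (fun y => k (x, y))) =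
      Rintegral m2 setT (fun y => Rintegral m1 setT (fun x => k (x, y)))].
Proof.
move=> ik ik1 ik2.
have E1 : EFin \o (fun x => Rintegral m2 setT (fun y => k (x, y))) =
    fubini_F m2 (EFin \o k).
  by apply/funext => x /=; rewrite /Rintegral fineK// integrable_fin_num//; exact: ik1.
have E2 : EFin \o (fun y => Rintegral m1 setT (fun x => k (x, y))) =
    fubini_G m1 (EFin \o k).
  by apply/funext => y /=; rewrite /Rintegral fineK// integrable_fin_num//; exact: ik2.
split; first by rewrite E1; exact: integrable_fubini_F.
  by apply/measurable_EFinP; rewrite E2; exact: (measurable_fubini_G ik).
rewrite [LHS]/Rintegral [RHS]/Rintegral.
transitivity (fine (\int[m1]_x fubini_F m2 (EFin \o k) x)%E); first by rewrite -E1.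
transitivity (fine (\int[m2]_y fubini_G m1 (EFin \o k) y)%E); last by rewrite -E2.
by rewrite Fubini.
Qed.

End real_valued_integrals.

(** * The antiderivative of [f] *)

Section antiderivative.
Context {R : realType}.
Local Notation mu := (@lebesgue_measure R).
Implicit Types f : R -> R.

(** On [-1, 1], where the weight |x| gives no control, continuity bounds [f] by a constant; outside,
    |f| <= |x| |f|. *)
Lemma moment_integrable f : continuous f ->
  mu.-integrable setT (fun x => (`|x| * f x)%:E) -> mu.-integrable setT (EFin \o f).
Proof.
move=> cf im.
have cn : {within `[(-1 : R), 1], continuous (fun x : R => `|f x|)}.
  apply: continuous_subspaceT => x.
  apply: (@continuous_comp _ _ _ f Num.norm); first exact: cf.
  exact: norm_continuous.
have N11 : -1 <= 1 :> R by lra.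
have [c _ cmax] := EVT_max N11 cn.
apply: (@integrable_of_le _ _ _ mu _ (fun x =>
  `|f c| * \1_(`[(-1 : R), 1]%classic) x + `| `|x| * f x|)).
- exact: continuous_measurable_fun.
- move=> x; rewrite indicE; case: (boolP (x \in _)).
    by rewrite inE/= => xI; rewrite mulr1 (le_trans (cmax x xI))// lerDl.
  rewrite notin_setE/= in_itv/= => xI; rewrite mulr0 add0r normrM normr_id.
  rewrite ler_peMl// leNgt; apply/negP => /ltr_normlP[x1 x2]; apply: xI.
  by apply/andP; split; lra.
- apply: integrable_add; last exact: (integrable_norm im).
  by apply: integrable_scale; exact: integrable_indic_itv.
Qed.

Definition antiderivative f (x : R) : R :=
  Rintegral mu setT (fun t => (if t <= x then 1 else 0) * f t).

Variable f : R -> R.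
Hypotheses (if0 : mu.-integrable setT (EFin \o f))
  (if1 : mu.-integrable setT (fun x => (`|x| * f x)%:E))
  (f0 : Rintegral mu setT f = 0).
Local Notation F := (antiderivative f).

Let mf : measurable_fun [set: R] f.
Proof. by apply/measurable_EFinP; exact: measurable_int if0. Qed.

(* Since [f] has mean 0, [F x] is minus the integral of [f] over []x, +oo[]; for
   [0 <= x] this form is used, so that [ker (x, t)] vanishes unless [|x| <= |t|]. *)
Let ker (p : R * R) : R :=
  ((if p.2 <= p.1 then 1 else 0) - (if 0 <= p.1 then 1 else 0)).

Lemma integrable_half_line (x : R) : mu.-integrable setT (EFin \o (fun t =>
  (if t <= x then 1 else 0) * f t)).
Proof.
apply: (@integrable_of_le _ _ _ mu _ (fun t => `|f t|)) => //.
- apply: measurable_funM => //; apply: measurable_fun_ifT => //.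
  exact: measurable_fun_ler.
- by move=> t; case: ifP; rewrite ?mul1r// mul0r normr0.
- exact: integrable_norm.
Qed.

Lemma antiderivative_ker x : F x = Rintegral mu setT (fun t => ker (x, t) * f t).
Proof.
rewrite /ker/=; under [RHS]eq_Rintegral do rewrite mulrBl.
rewrite RintegralB ?RintegralZl ?f0 ?mulr0 ?subr0//.
- exact: integrable_half_line.
- exact: integrable_scale.
Qed.

Let ker_abs x t : `|ker (x, t)| = \1_(if t
  <= 0 then `[t, 0[%classic else `[0, t[%classic) x.
Proof.
rewrite /ker/= indicE; case: (leP t 0) => t0; rewrite mem_setE in_itv/=.
  by case: (leP 0 x) => x0; case: (leP t x) => tx;
    rewrite ?subrr ?subr0 ?normr0 ?normr1//; lra.
by case: (leP 0 x) => x0; case: (leP t x) => tx;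
    rewrite ?subrr ?sub0r ?normrN ?normr0 ?normr1//; lra.
Qed.

Let ker_mu t : (\int[mu]_x (`|ker (x, t)|)%:E = `|t|%:E)%E.
Proof.
under eq_integral do rewrite ker_abs.
rewrite integral_indic//; last by case: ifP => _; exact: measurable_itv.
rewrite setIT; case: (leP t 0) => t0; rewrite /= lebesgue_measure_itv/= lte_fin.
  case: ltP => h; first by rewrite -EFinB sub0r ler0_norm.
  have -> : t = 0 by lra.
  by rewrite normr0.
by rewrite t0 -EFinB subr0 gtr0_norm.
Qed.

Let mker : measurable_fun setT ker.
Proof.
apply: measurable_funB; apply: measurable_fun_ifT => //; exact: measurable_fun_ler.
Qed.

(** Tonelli, integrating in x before t: for fixed t, |ker (x, t)| is the indicator of an interval
    with endpoints 0 and t, of length |t|. The double integral of |ker (x, t) f(t)| is thus the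
    first absolute moment of [f]. *)
Lemma antiderivative_integrable : mu.-integrable setT (EFin \o F).
Proof.
have mk : measurable_fun setT (EFin \o (fun p : R * R => ker p * f p.2)).
  by apply/measurable_EFinP/measurable_funM => //; exact: measurableT_comp.
have ik : (mu \x mu)%E.-integrable setT (EFin \o (fun p : R * R => ker p * f p.2)).
  apply/integrable21ltyP => //=.
  move/integrableP : if1 => [_]; apply: le_lt_trans.
  rewrite le_eqVlt; apply/orP; left; apply/eqP.
  apply: eq_integral => t _; rewrite /= normrM normr_id EFinM -ker_mu.
  rewrite muleC -ge0_integralZl//.
  - by apply: eq_integral => x _; rewrite -EFinM normrM mulrC.
  - apply/measurable_EFinP; apply: measurableT_comp => //.
    exact: (measurableT_comp mker (pair2_measurable t)).
have E : EFin \o F = fubini_F mu (EFin \o (fun p : R * R => ker p * f p.2)).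
  apply/funext => x; rewrite /= antiderivative_ker /Rintegral fineK//.
  apply: integrable_fin_num => //;
    apply: (@integrable_of_le _ _ _ mu _ (fun t => `|f t|)).
  - apply: measurable_funM => //; exact: (measurableT_comp mker (pair1_measurable x)).
  - by move=> t; rewrite normrM ker_abs ler_piMl// indicE; case: (x \in _).
  - exact: integrable_norm.
by rewrite E; exact: integrable_fubini_F.
Qed.

Lemma antiderivative_bounded x : `|F x| <= Rintegral mu setT (fun t => `|f t|).
Proof.
apply: (le_trans (le_normr_Rintegral measurableT (integrable_half_line x))).
apply: le_Rintegral => //; try exact: integrable_norm.
  by apply: integrable_norm; exact: integrable_half_line.
by move=> t _; case: ifP; rewrite ?mul1r// mul0r normr0.
Qed.

(** Where [ker (x, t)] is nonzero one has |x| <= |t|, so the factor |x| can be taken under the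
    integral and replaced by |t|. *)
Lemma antiderivative_decay x :
  `|x| * `|F x| <= Rintegral mu setT (fun t => `|t| * `|f t|).
Proof.
have iK : mu.-integrable setT (EFin \o (fun t => ker (x, t) * f t)).
  apply: (@integrable_of_le _ _ _ mu _ (fun t => `|f t|)).
  - apply: measurable_funM => //; exact: (measurableT_comp mker (pair1_measurable x)).
  - by move=> t; rewrite normrM ker_abs ler_piMl// indicE; case: (x \in _).
  - exact: integrable_norm.
rewrite antiderivative_ker.
apply: (@le_trans _ _ (`|x| * Rintegral mu setT (fun t => `|ker (x, t) * f t|))).
  by rewrite ler_wpM2l// le_normr_Rintegral.
rewrite -RintegralZl//; last exact: integrable_norm.
apply: le_Rintegral => //.
- by apply: integrable_scale; exact: integrable_norm.
- rewrite (_ : EFin \o _ = EFin \o (fun t => `| `|t| * f t |)).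
    exact: integrable_norm.
  by apply/funext => t /=; rewrite normrM normr_id.
- move=> t _; rewrite normrM mulrA ler_wpM2r//.
  rewrite /ker/=; case: (leP t x) => tx; case: (leP 0 x) => x0;
    rewrite ?subrr ?sub0r ?subr0 ?normrN ?normr0 ?normr1 ?mulr0 ?mulr1//.
  + by rewrite !ltr0_norm; lra.
  + by rewrite !ger0_norm; lra.
Qed.

End antiderivative.

(** * Mollification at Lebesgue points *)

Section mollifier.
Context {R : realType}.
Local Notation mu := (@lebesgue_measure R).
Local Notation ds := (derive1 (@step R)).

Lemma continuous_derive_step : continuous ds.
Proof. exact: smooth_continuous (smooth_derive smooth_step). Qed.

Lemma measurable_derive_step : measurable_fun [set: R] ds.
Proof. exact: continuous_measurable_fun continuous_derive_step. Qed.

Lemma integrable_derive_step : mu.-integrable setT (EFin \o ds).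
Proof.
have [M M0 hM] := @derive_step_bounded R.
apply: (@integrable_of_le _ _ _ mu _ (fun x : R => M * \1_`[(0 : R), 1] x)).
- exact: measurable_derive_step.
- move=> x; rewrite indicE; case: (boolP (x \in _)); first by rewrite mulr1.
  rewrite notin_setE/= in_itv/= => /negP; rewrite negb_and -!ltNge => xo.
  by rewrite derive_step_out// normr0 mulr0.
- by apply: integrable_scale; exact: integrable_indic_itv.
Qed.

Lemma Rintegral_derive_step : Rintegral mu setT ds = 1.
Proof.
transitivity (Rintegral mu `[(0 : R), 1] ds).
  rewrite [RHS]Rintegral_mkcond; apply: eq_Rintegral => x _; rewrite patchE.
  case: ifPn => //; rewrite notin_setE/= in_itv/= => /negP; rewrite negb_and -!ltNge.
  exact: derive_step_out.
rewrite /Rintegral (@continuous_FTC2 _ ds (@step R))//.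
- by rewrite step1// step0//= subr0.
- by apply: continuous_subspaceT; exact: continuous_derive_step.
- have cs : continuous (@step R) by exact: smooth_continuous smooth_step.
  split.
  + by move=> x _; exact: smooth_derivable smooth_step.
  + by apply: cvg_at_right_filter; exact: cs.
  + by apply: cvg_at_left_filter; exact: cs.
Qed.

(** This is the derivative of [smooth_jump n c]: a kernel of mass 1 concentrated on
    [c, c + 1/(n+1)], to the right of c. The argument is kept in the form a y + b to which the
    affine change of variables applies. *)
Definition mollifier (n : nat) (c y : R) : R :=
  n.+1%:R * ds (n.+1%:R * y + - (n.+1%:R * c)).

Lemma measurable_mollifier n c : measurable_fun [set: R] (mollifier n c).
Proof.
apply: measurable_funM => //; apply: (measurableT_comp measurable_derive_step).
exact: measurable_affine.
Qed.

Lemma integrable_mollifier n c : mu.-integrable setT (EFin \o mollifier n c).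
Proof.
apply: integrable_scale; apply: (integrable_affine _ _ integrable_derive_step).
by rewrite pnatr_eq0.
Qed.

Lemma Rintegral_mollifier n c : Rintegral mu setT (mollifier n c) = 1.
Proof.
have n0 : n.+1%:R != 0 :> R by rewrite pnatr_eq0.
rewrite RintegralZl//; last exact: (integrable_affine _ n0 integrable_derive_step).
have := Rintegral_affine (- (n.+1%:R * c)) n0 integrable_derive_step.
by rewrite Rintegral_derive_step ger0_norm.
Qed.

Lemma mollifier_bounded n c : exists M, forall y, `|mollifier n c y| <= M.
Proof.
have [M M0 hM] := @derive_step_bounded R.
exists (n.+1%:R * M) => y; rewrite normrM ger0_norm// ler_wpM2l//.
Qed.

Lemma integrable_mul_bounded d (T : measurableType d) (m : {measure set T -> \bar R})
    (g h : T -> R) (M : R) : m.-integrable setT (EFin \o g) ->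
  measurable_fun setT h -> (forall x, `|h x| <= M) ->
  m.-integrable setT (EFin \o (fun x => g x * h x)).
Proof.
move=> ig mh hM; apply: (@integrable_of_le _ _ _ m _ (fun x => M * `|g x|)).
- by apply: measurable_funM => //; apply/measurable_EFinP; exact: measurable_int ig.
- by move=> x; rewrite normrM mulrC ler_wpM2r.
- by apply: integrable_scale; exact: integrable_norm.
Qed.

Lemma integrable_mul_mollifier (u : R -> R) n c : mu.-integrable setT (EFin \o u) ->
  mu.-integrable setT (EFin \o (fun y => u y * mollifier n c y)).
Proof.
move=> iu; have [M hM] := mollifier_bounded n c.
exact: (integrable_mul_bounded iu (measurable_mollifier n c) hM).
Qed.

(** As the kernel has mass 1, the error is the integral of (u - u(c)) against it. The kernel is at
    most (n+1) M and lives in a small ball around c, so the error is controlled by the mean of |u -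
    u(c)| over that ball, which tends to 0 at a Lebesgue point. *)
Lemma mollifier_cvg (u : R -> R) c : mu.-integrable setT (EFin \o u) ->
  lebesgue_pt u c ->
  Rintegral mu setT (fun y => u y * mollifier n c y) @[n --> \oo] --> u c.
Proof.
move=> iu uc; have [M M0 hM] := @derive_step_bounded R.
(* Twice the width of the kernel, so that points off the open ball lie strictly outside
   [c, c + 1/(n+1)]. The ball has measure 4/(n+1), whence the constant 4 M in front of the
   average. *)
pose r (n : nat) : R := 2 / n.+1%:R.
have r0 n : 0 < r n by rewrite divr_gt0.
have rcvg : r n @[n --> \oo] --> (0 : R).
  by rewrite -[X in _ --> X](mulr0 (2 : R)); apply: cvgMr; exact: cvg_harmonic.
have davg0 : davg u c (r n) @[n --> \oo] --> 0%E.
  by move/cvge_at_rightP : uc; apply; split.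
have mu_u : measurable_fun setT u by apply/measurable_EFinP; exact: measurable_int iu.
have le n : (`|Rintegral mu setT (fun y => u y * mollifier n c y) - u c|%:E <=
    (4 * M)%:E * davg u c (r n))%E.
  have iuc : mu.-integrable setT (EFin \o (fun y => u c * mollifier n c y)).
    by apply: integrable_scale; exact: integrable_mollifier.
  have iuu := integrable_mul_mollifier n c iu.
  rewrite -[X in _ - X]mulr1 -[X in _ * X](Rintegral_mollifier n c).
  rewrite -RintegralZl//; last exact: integrable_mollifier.
  rewrite -RintegralB//.
  have idiff := integrable_sub iuu iuc.
  rewrite (EFin_normr_Rintegral measurableT idiff).
  apply: (le_trans (le_abse_integral _ _ _)) => //; first exact: measurable_int idiff.
  rewrite /davg /iavg lebesgue_measure_ball; last exact: ltW.
  rewrite inver mulrn_eq0/= (gt_eqF (r0 n)) muleA -EFinM.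
  have mpatch : measurable_fun setT ((fun y => `|u y - u c|%:E) \_ (ball c (r n))).
    apply/(measurable_restrictT _ _).1 => //; first exact: measurable_ball.
    apply/measurable_EFinP; apply: measurableT_comp => //.
    by apply: measurable_funB => //; exact: measurable_funTS.
  rewrite [X in (_ <= _ * X)%E]integral_mkcond -ge0_integralZl//; last first.
    by rewrite lee_fin mulr_ge0// ?mulr_ge0 ?(ltW M0)// invr_ge0 mulrn_wge0 ?(ltW
      (r0 _)).
    by move=> x _; rewrite patchE; case: ifP => // _; rewrite lee_fin.
  apply: ge0_le_integral => //=.
  - by apply/measurable_EFinP; apply: measurableT_comp => //; apply/measurable_EFinP;
    exact: measurable_int idiff.
  - by apply: measurable_funeM; exact: mpatch.
  move=> x _; rewrite patchE -mulrBl normrM; case: ifPn => [_|].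
    rewrite -EFinM lee_fin mulrC ler_wpM2r// normrM ger0_norm//.
    have -> : 4 * M / (r n *+ 2) = n.+1%:R * M.
      have n0 : n.+1%:R != 0 :> R by rewrite pnatr_eq0.
      rewrite /r -mulr_natr; move: (n.+1%:R : R) n0 => N n0; field; exact: n0.
    by rewrite ler_wpM2l.
  rewrite notin_setE/= /ball/= => /negP; rewrite -leNgt ler_pdivrMr// => h.
  rewrite mule0 /mollifier derive_step_out ?mulr0 ?normr0 ?mulr0//.
  rewrite -mulrN -mulrDr.
  have [xc|xc] := ltP x c; apply/orP; first by left; rewrite pmulr_rlt0// subr_lt0.
  by right; move: h; rewrite ler0_norm ?subr_le0// opprB mulrC; lra.
suff h : `|Rintegral mu setT (fun y =>
  u y * mollifier n c y) - u c| @[n --> \oo] --> (0:R).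
  by apply/subr_cvg0; apply: norm_cvg0.
have : (`|Rintegral mu setT (fun y =>
  u y * mollifier n c y) - u c|)%:E @[n --> \oo] --> (0%:E)%E.
  apply: (squeeze_cvge _ (cvg_cst 0%E)); last first.
    rewrite -[X in _ --> X](mule0 (4 * M)%:E); apply: cvgeZl => //; exact: davg0.
  by apply: nearW => n; rewrite lee_fin normr_ge0 le.
exact: fine_cvg.
Qed.
End mollifier.

(** * Functions of bounded variation as distribution functions *)

Section representation.
Context {R : realType}.
Local Notation mu := (@lebesgue_measure R).
Local Notation fmeasure := {finite_measure set (measurableTypeR R) -> \bar R}.

Definition cdf (a : fmeasure) (x : R) : R := fine (a `]-oo, x]%classic).

Definition smooth_jump (n : nat) (c y : R) : R := step (n.+1%:R * y + - (n.+1%:R * c)).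

Lemma smooth_smooth_jump n c : smooth (smooth_jump n c).
Proof. exact: smooth_affine smooth_step. Qed.

Lemma derive_smooth_jump n c : derive1 (smooth_jump n c) = mollifier n c.
Proof.
have ds (x : R) : derivable (@step R) x 1 by exact: smooth_derivable smooth_step.
exact: (derive1_affine n.+1%:R (- (n.+1%:R * c)) ds).2.
Qed.

Lemma measurable_smooth_jump n c : measurable_fun [set: R] (smooth_jump n c).
Proof.
apply: continuous_measurable_fun; apply: smooth_continuous; exact: smooth_smooth_jump.
Qed.

Lemma smooth_jump_bounded n c y : `|smooth_jump n c y| <= 1.
Proof. by rewrite ger0_norm ?step_ge0// step_le1. Qed.

Lemma smooth_jump_left n c y : y <= c -> smooth_jump n c y = 0.
Proof. by move=> yc; rewrite /smooth_jump step0// -mulrN -mulrDr pmulr_rle0//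
  subr_le0. Qed.

Lemma smooth_jump_right n c y : c + n.+1%:R^-1 <= y -> smooth_jump n c y = 1.
Proof.
by move=> yc; rewrite /smooth_jump step1// -mulrN -mulrDr -ler_pdivrMl// mulr1 lerBrDl.
Qed.

(** The ramp occupies [c, c + 1/(n+1)] and is 0 at c itself, so the limit is the indicator of the
    open half-line. Its complement is the closed half-line measured by [cdf]; an atom at c is
    therefore counted on the correct side. *)
Lemma smooth_jump_cvg c y :
  smooth_jump n c y @[n --> \oo] --> (\1_(`]c, +oo[%classic) y : R).
Proof.
rewrite indicE mem_setE in_itv/= andbT; case: ltP => yc; last first.
  rewrite (_ : (fun n => _) = cst 0); first exact: cvg_cst.
  by apply/funext => n; rewrite smooth_jump_left.
apply: cvg_near_cst; near=> n; apply: smooth_jump_right.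
rewrite -lerBrDl; near: n.
have yc0 : 0 < y - c by rewrite subr_gt0.
have /cvgrPdist_le/(_ _ yc0) := @cvg_harmonic R.
apply: filterS => n /=; rewrite sub0r normrN ger0_norm// invr_ge0//.
Unshelve. all: by end_near. Qed.

Lemma integral_smooth_jump_cvg (a : fmeasure) c :
  Rintegral a setT (smooth_jump n c) @[n --> \oo] --> fine (a setT) - cdf a c.
Proof.
have -> : fine (a setT) - cdf a c = Rintegral a setT (\1_(`]c, +oo[%classic)).
  rewrite /Rintegral integral_indic// setIT /cdf.
  have <- : `]-oo, c]%classic `|` `]c, +oo[%classic = [set: R].
    by rewrite -itv_bndbnd_setU// set_itvE.
  rewrite measureU//; last first.
    apply/seteqP; split=> // x [] /=; rewrite !in_itv/= andbT => h1 h2; lra.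
  by rewrite fineD ?fin_num_measure// addrAC subrr add0r.
apply: (dominated_Rintegral (G := cst 1) _ _ _ _).2.
- by move=> n; exact: measurable_smooth_jump.
- by move=> x; exact: smooth_jump_cvg.
- exact: finite_measure_integrable_cst.
- by move=> n x; exact: smooth_jump_bounded.
Qed.

(** One [smooth_jump] equals 1 far to the right and has no compact support. In the difference of
    two, for a < b, the values 1 cancel beyond b + 1, uniformly in n since 1/(n+1) <= 1. *)
Definition smooth_plateau n a b y := smooth_jump n a y + -1 * smooth_jump n b y.

Lemma smooth_plateau_left n a b y : a < b -> y < a -> smooth_plateau n a b y = 0.
Proof. by move=> ab ya; rewrite /smooth_plateau !smooth_jump_left ?mulr0 ?addr0;
  lra. Qed.

Lemma smooth_plateau_right n a b y : a < b -> b + 1 < y -> smooth_plateau n a b y = 0.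
Proof.
move=> ab yb; have n1 : n.+1%:R^-1 <= 1 :> R by rewrite invf_le1// ler1n.
have [ya yb'] : a + n.+1%:R^-1 <= y /\ b + n.+1%:R^-1 <= y.
  by move: (n.+1%:R^-1 : R) n1 => e e1; split; lra.
by rewrite /smooth_plateau !smooth_jump_right// mulr1 subrr.
Qed.

Lemma smooth_plateau_test n a b : a < b -> test_function (smooth_plateau n a b).
Proof.
move=> ab; split.
  by apply: smoothD; [|apply: smoothZ]; exact: smooth_smooth_jump.
apply: (@subclosed_compact _ _ `[a, b + 1]%classic).
- exact: closed_closure.
- exact: segment_compact.
- have /closure_id -> : closed `[a, b + 1]%classic by exact: itv_closed.
  apply: closureS => y /=; rewrite in_itv/=; apply: contraR.
  rewrite negb_and -!ltNge => /orP[ya|yb]; apply/eqP.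
    exact: smooth_plateau_left.
  exact: smooth_plateau_right.
Qed.

Lemma derive_smooth_plateau n a b :
  derive1 (smooth_plateau n a b) = fun y => mollifier n a y - mollifier n b y.
Proof.
apply/funext => y; rewrite derive1E.
have da : derivable (smooth_jump n a) y 1.
  by apply: smooth_derivable; exact: smooth_smooth_jump.
have db : derivable (smooth_jump n b) y 1.
  by apply: smooth_derivable; exact: smooth_smooth_jump.
have -> : smooth_plateau n a b = smooth_jump n a + (-1 *: smooth_jump n b) by [].
rewrite deriveD//; last exact: derivableZ.
by rewrite deriveZ// -!derive1E !derive_smooth_jump scaleN1r.
Qed.

(** The derivative of the plateau is a mollifier at a minus a mollifier at b, so the left side of
    the distributional identity tends to u(a) - u(b). On the right, each Jordan part yields in the
    limit its mass of ]a, b]. *)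
Lemma increment_at_lebesgue_pt (u : R -> R)
    (nu : {charge set (measurableTypeR R) -> \bar R})
    (P N : set (measurableTypeR R)) (nuPN : hahn_decomposition nu P N) a b :
  mu.-integrable setT (EFin \o u) -> distributional_derivative u nu ->
  lebesgue_pt u a -> lebesgue_pt u b -> a < b ->
  u b - u a = (cdf (jordan_pos nuPN) b - cdf (jordan_neg nuPN) b)
              - (cdf (jordan_pos nuPN) a - cdf (jordan_neg nuPN) a).
Proof.
move=> iu du ua ub ab.
have intE n : Rintegral mu setT (fun y => u y * mollifier n a y) -
      Rintegral mu setT (fun y => u y * mollifier n b y) =
    - ((Rintegral (jordan_pos nuPN) setT (smooth_jump n a) -
        Rintegral (jordan_pos nuPN) setT (smooth_jump n b)) -
       (Rintegral (jordan_neg nuPN) setT (smooth_jump n a) -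
        Rintegral (jordan_neg nuPN) setT (smooth_jump n b))).
  have := du P N nuPN _ (smooth_plateau_test n ab).
  rewrite derive_smooth_plateau.
  under eq_Rintegral do rewrite mulrBr.
  rewrite RintegralB//;
    [|exact: integrable_mul_mollifier|exact: integrable_mul_mollifier].
  move=> ->; rewrite /charge_integral.
  have E (m : fmeasure) : Rintegral m setT (smooth_plateau n a b) =
      Rintegral m setT (smooth_jump n a) - Rintegral m setT (smooth_jump n b).
    rewrite -RintegralB//; last 2 first.
    - apply: (@finite_integrable _ _ _ _ _ 1) => [|x];
      [exact: measurable_smooth_jump|exact: smooth_jump_bounded].
    - apply: (@finite_integrable _ _ _ _ _ 1) => [|x];
      [exact: measurable_smooth_jump|exact: smooth_jump_bounded].
    by apply: eq_Rintegral => y _; rewrite /smooth_plateau mulN1r.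
  by rewrite !E.
have l1 : Rintegral mu setT (fun y => u y * mollifier n a y) -
    Rintegral mu setT (fun y => u y * mollifier n b y) @[n --> \oo] --> u a - u b.
  by apply: cvgB; exact: mollifier_cvg.
have lm (m : fmeasure) : Rintegral m setT (smooth_jump n a) -
    Rintegral m setT (smooth_jump n b) @[n --> \oo] --> cdf m b - cdf m a.
  have -> : cdf m b - cdf m a = (fine (m setT) - cdf m a) - (fine
    (m setT) - cdf m b) by lra.
  by apply: cvgB; exact: integral_smooth_jump_cvg.
have l2 := @cvgN _ _ _ _ _ _ _ (@cvgB _ _ _ _ _ _ _ _ _ (lm (jordan_pos nuPN)) (lm
  (jordan_neg nuPN))).
suff : u a - u b = - ((cdf (jordan_pos nuPN) b - cdf (jordan_pos nuPN) a) -
  (cdf (jordan_neg nuPN) b - cdf (jordan_neg nuPN) a)) by lra.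
rewrite -(cvg_lim _ l1)//; apply: cvg_lim => //.
rewrite (_ : (fun n => _) = (fun n =>
  - ((Rintegral (jordan_pos nuPN) setT (smooth_jump n a) -
        Rintegral (jordan_pos nuPN) setT (smooth_jump n b)) -
       (Rintegral (jordan_neg nuPN) setT (smooth_jump n a) -
        Rintegral (jordan_neg nuPN) setT (smooth_jump n b))))); last exact/funext.
exact: l2.
Qed.

Lemma BV_representation (u : R -> R)
    (nu : {charge set (measurableTypeR R) -> \bar R})
    (P N : set (measurableTypeR R)) (nuPN : hahn_decomposition nu P N) :
  mu.-integrable setT (EFin \o u) -> distributional_derivative u nu ->
  exists k, {ae mu, forall y,
    u y = k + (cdf (jordan_pos nuPN) y - cdf (jordan_neg nuPN) y)}.
Proof.
move=> iu du.
pose V y := cdf (jordan_pos nuPN) y - cdf (jordan_neg nuPN) y.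
have aeu : {ae mu, forall x, lebesgue_pt u x}.
  by apply: lebesgue_differentiation; apply: open_integrable_locally => //;
    exact: openT.
have [[a ua]|nopt] := pselect (exists a, lebesgue_pt u a); last first.
  (* An arbitrary constant: if no Lebesgue point existed, almost every x would give a
     contradiction. *)
  exists 0; move: aeu; apply: filterS; first exact: (ae_filter_ringOfSetsType mu).
  by move=> x ux; exfalso; apply: nopt; exists x.
(* The increments of [u] and [V] agree between any two Lebesgue points, so u - V takes the same
   value at all of them. *)
exists (u a - V a); move: aeu.
apply: filterS; first exact: (ae_filter_ringOfSetsType mu).
move=> y uy; rewrite -/(V y).
have [ay|ya|->] := ltgtP a y; last by lra.
  by have := increment_at_lebesgue_pt nuPN iu du ua uy ay; rewrite -/(V y) -/(V a); lra.
by have := increment_at_lebesgue_pt nuPN iu du uy ua ya; rewrite -/(V y) -/(V a); lra.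
Qed.

End representation.

(** * One-sided limits and jumps *)

Section jumps.
Context {R : realType}.
Local Notation mu := (@lebesgue_measure R).
Local Notation fmeasure := {finite_measure set (measurableTypeR R) -> \bar R}.
Implicit Types (a : fmeasure) (u V : R -> R) (x y l : R).

Definition atom a x : R := fine (a [set x]).

Lemma cdfE a x : cdf a x = Rintegral a setT (\1_(`]-oo, x]%classic)).
Proof. by rewrite /Rintegral integral_indic// setIT. Qed.

Lemma cdf_left a x : cdf a x - atom a x = Rintegral a setT (\1_(`]-oo, x[%classic)).
Proof.
rewrite /Rintegral integral_indic// setIT /cdf /atom.
have <- : `]-oo, x[%classic `|` [set x] = `]-oo, x]%classic by rewrite setUitv1.
rewrite measureU//; last first.
  by apply/seteqP; split=> // y [] /=; rewrite in_itv/= => /[swap] ->; rewrite ltxx.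
by rewrite fineD ?fin_num_measure// addrK.
Qed.

Let indic_bounded (A : set R) y : `|\1_A y| <= (1 : R).
Proof. by rewrite indicE; case: (y \in A); rewrite ?normr1 ?normr0. Qed.

Lemma cdf_cvg_right a x : cdf a y @[y --> x^'+] --> cdf a x.
Proof.
apply/cvg_at_rightP => s [xs sx]; rewrite cdfE.
under eq_fun do rewrite cdfE.
apply: (dominated_Rintegral (G := cst 1) _ _ _ _).2.
- by move=> n; exact: measurable_indic.
- move=> t; rewrite indicE mem_setE in_itv/=; case: leP => tx.
    apply: cvg_near_cst; apply: nearW => n.
    by rewrite indicE mem_setE in_itv/= (le_trans tx) ?ltW.
  apply: cvg_near_cst; near=> n; rewrite indicE mem_setE in_itv/= leNgt.
  suff -> : s n < t by [].
  by near: n; exact: (cvgr_lt x).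
- exact: finite_measure_integrable_cst.
- by move=> n y; exact: indic_bounded.
Unshelve. all: by end_near. Qed.

(** As y increases to x, the indicators of ]-oo, y] converge to that of the open half-line ]-oo, x[,
    and the atom at x is lost. From the right the limit is the closed half-line and keeps it. *)
Lemma cdf_cvg_left a x : cdf a y @[y --> x^'-] --> cdf a x - atom a x.
Proof.
apply/cvg_at_leftP => s [xs sx]; rewrite cdf_left.
under eq_fun do rewrite cdfE.
apply: (dominated_Rintegral (G := cst 1) _ _ _ _).2.
- by move=> n; exact: measurable_indic.
- move=> t; rewrite indicE mem_setE in_itv/=; case: ltP => tx.
    apply: cvg_near_cst; near=> n; rewrite indicE mem_setE in_itv/=.
    suff -> : t <= s n by [].
    by near: n; exact: (cvgr_ge x).
  apply: cvg_near_cst; apply: nearW => n.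
  by rewrite indicE mem_setE in_itv/= leNgt (lt_le_trans (xs n)).
- exact: finite_measure_integrable_cst.
- by move=> n y; exact: indic_bounded.
Unshelve. all: by end_near. Qed.

Lemma iavg_le (u V : R -> R) l (A : set R) (e h : R) : measurable_fun setT u ->
  measurable A -> mu A = h%:E -> 0 < h ->
  {ae mu, forall y, u y = V y} -> (forall y, A y -> `|V y - l| <= e) ->
  (iavg (fun y => (u y - l)%R) A <= e%:E)%E.
Proof.
move=> mu_ mA muA h0 uV Ve.
have e0 : 0 <= e.
  (* [A] has positive measure, hence contains a point y, and [e] dominates |V y - l|. *)
  have [A0|/set0P[y Ay]] := eqVneq A set0.
    by move: muA; rewrite A0 measure0 => -[] h00; move: h0; rewrite -h00 ltxx.
  by apply: le_trans (Ve y Ay).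
rewrite /iavg muA inver gt_eqF//.
have : (\int[mu]_(y in A) `|(u y - l)%:E| <= \int[mu]_(y in A) (cst e%:E) y)%E.
  apply: ae_ge0_le_integral => //.
  - apply: measurableT_comp => //; apply/measurable_EFinP.
    by apply: measurable_funB => //; exact: measurable_funTS.
  - move: uV; apply: filterS; first exact: (ae_filter_ringOfSetsType mu).
    by move=> y uy Ay; rewrite uy lee_fin; exact: Ve.
rewrite integral_cst//= muA => le1.
apply: (@le_trans _ _ ((h^-1)%:E * (e%:E * h%:E))%E).
  by apply: lee_wpmul2l => //; rewrite lee_fin invr_ge0 ltW.
by rewrite -!EFinM mulrCA mulVf ?gt_eqF// mulr1.
Qed.

Lemma iavg_cvg0 u l (A : R -> set R) :
  (forall e, 0 < e -> \forall h \near 0^'+, (iavg (fun y =>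
    (u y - l)%R) (A h) <= e%:E)%E) ->
  iavg (fun y => u y - l) (A h) @[h --> 0^'+] --> 0%E.
Proof.
move=> H; apply/cvge_at_rightP => s [s0 scvg].
apply/fine_cvgP; split.
  have [d /= d0 Hd] := H 1 ltr01.
  have /cvgrPdist_lt/(_ d d0) := scvg; apply: filterS => n sn.
  rewrite ge0_fin_numE ?iavg_ge0//; apply: le_lt_trans (ltry 1).
  exact: Hd.
apply/cvgrPdist_le => e e0.
have [d /= d0 Hd] := H e e0.
have /cvgrPdist_lt/(_ d d0) := scvg; apply: filterS => n sn.
have h := Hd _ sn (s0 n).
rewrite sub0r normrN ger0_norm ?fine_ge0 ?iavg_ge0//.
rewrite -lee_fin fineK// ge0_fin_numE ?iavg_ge0//.
exact: le_lt_trans h (ltry _).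
Qed.

(** Averages do not see null sets, so an ordinary one-sided limit of the representative [V] is an
    approximate limit of [u]. *)
Lemma right_limit_cvg u V x l : measurable_fun setT u ->
  {ae mu, forall y, u y = V y} -> V y @[y --> x^'+] --> l -> right_limit u x l.
Proof.
move=> mu_ uV Vl; apply: iavg_cvg0 => e e0.
have /cvgrPdist_le/(_ e e0)[d /= d0 Hd] := Vl.
near=> h; apply: (iavg_le (h := h) mu_ _ _ _ uV) => //.
- by rewrite lebesgue_measure_itv/= lte_fin ltrDl ifT// -EFinB addrAC subrr add0r.
- move=> y /=; rewrite in_itv/= => /andP[xy yh]; rewrite distrC; apply: Hd => //=.
  have hd : h < d by near: h; exact: nbhs_right_lt.
  by rewrite distrC gtr0_norm ?subr_gt0//; lra.
Unshelve. all: by end_near. Qed.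

Lemma left_limit_cvg u V x l : measurable_fun setT u ->
  {ae mu, forall y, u y = V y} -> V y @[y --> x^'-] --> l -> left_limit u x l.
Proof.
move=> mu_ uV Vl; apply: iavg_cvg0 => e e0.
have /cvgrPdist_le/(_ e e0)[d /= d0 Hd] := Vl.
near=> h; apply: (iavg_le (h := h) mu_ _ _ _ uV) => //.
- by rewrite lebesgue_measure_itv/= lte_fin ltrBlDr ltrDl ifT//
  -EFinB opprB addrC subrK.
- move=> y /=; rewrite in_itv/= => /andP[xy yh]; rewrite distrC; apply: Hd => //=.
  have hd : h < d by near: h; exact: nbhs_right_lt.
  by rewrite gtr0_norm ?subr_gt0//; lra.
Unshelve. all: by end_near. Qed.

(** The average of the constant |l1 - l2| is at most the sum of the averages of |u - l1| and |u -
    l2|, which tends to 0. *)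
Lemma iavg_limit_unique u l1 l2 (A : R -> set R) : measurable_fun setT u ->
  (forall h, measurable (A h)) -> (forall h, 0 < h -> mu (A h) = h%:E) ->
  iavg (fun y => u y - l1) (A h) @[h --> 0^'+] --> 0%E ->
  iavg (fun y => u y - l2) (A h) @[h --> 0^'+] --> 0%E -> l1 = l2.
Proof.
move=> mu_ mA muA h1 h2.
have h12 : (iavg (fun y => (u y - l1)%R) (A h) + iavg (fun y => (u y - l2)%R) (A h))%E
    @[h --> 0^'+] --> (0 + 0)%E by apply: cvgeD.
have : (`|l1 - l2|%:E <= 0)%E.
  rewrite -[leRHS](adde0 0%E); apply: (cvge_to_ge h12).
  near=> h.
  have h0 : 0 < h by near: h; exact: nbhs_right_gt.
  have : (iavg (cst (l1 - l2)%R) (A h) <= iavg (fun y =>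
    (u y - l2)%R) (A h) + iavg (fun y => (l1 - u y)%R) (A h))%E.
    rewrite (_ : cst _ = (fun y => u y - l2) \+ (fun y => l1 - u y)); last first.
      by apply/funext => y /=; lra.
    apply: iavgD => //; first by rewrite muA// ltry.
    - by apply: measurable_funB => //; exact: measurable_funTS.
    - by apply: measurable_funB => //; exact: measurable_funTS.
  rewrite [X in (X <= _)%E]/iavg (eq_integral (cst `|l1 - l2|%:E))// integral_cst;
    last exact: mA.
  rewrite /= (muA h h0) inver (gt_eqF h0) -!EFinM mulrCA mulVf ?(gt_eqF h0)// mulr1.
  rewrite (_ : iavg (fun y => (l1 - u y)%R) (A h) = iavg (fun y => (u y - l1)%R) (A h)).
    by rewrite addeC.
  by rewrite /iavg; congr (_ * _)%E; apply: eq_integral => y _;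
    rewrite abse_EFin distrC.
move=> l0; have : `|l1 - l2| <= 0 by rewrite -lee_fin.
by rewrite normr_le0 subr_eq0 => /eqP.
Unshelve. all: by end_near. Qed.

Lemma right_limit_unique u x l1 l2 : measurable_fun setT u ->
  right_limit u x l1 -> right_limit u x l2 -> l1 = l2.
Proof.
move=> mu_; apply: iavg_limit_unique => // h h0.
by rewrite lebesgue_measure_itv/= lte_fin ltrDl h0 -EFinB addrAC subrr add0r.
Qed.

Lemma left_limit_unique u x l1 l2 : measurable_fun setT u ->
  left_limit u x l1 -> left_limit u x l2 -> l1 = l2.
Proof.
move=> mu_; apply: iavg_limit_unique => // h h0.
by rewrite lebesgue_measure_itv/= lte_fin ltrBlDr ltrDl h0 -EFinB opprB addrC subrK.
Qed.

(** The representative k + [cdf p] - [cdf n] has both one-sided limits at every point, so [uplus]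
    and [uminus] are true limits everywhere, never default values of [get]. They differ by
    [atom p x - atom n x], which is 0 off the jump set; the sum thus extends to all reals. *)
Lemma jump_sum (p n : fmeasure) (u : R -> R) (k : R) : measurable_fun setT u ->
  {ae mu, forall y, u y = k + (cdf p y - cdf n y)} ->
  \esum_(x in jump_set u) (`|uplus u x - uminus u x| ^+ 2)%:E =
  \esum_(x in [set: R]) ((atom p x - atom n x) ^+ 2)%:E.
Proof.
move=> mu_ uV.
pose V y := k + (cdf p y - cdf n y).
pose r x := V x.
pose l x := k + ((cdf p x - atom p x) - (cdf n x - atom n x)).
have ur x : right_limit u x (r x).
  apply: (right_limit_cvg mu_ uV); apply: cvgD; first exact: cvg_cst.
  by apply: cvgB; exact: cdf_cvg_right.
have ul x : left_limit u x (l x).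
  apply: (left_limit_cvg mu_ uV); apply: cvgD; first exact: cvg_cst.
  by apply: cvgB; exact: cdf_cvg_left.
have up x : uplus u x = r x.
  by apply: get_unique => [|y uy];
    [exact: ur|exact: (@right_limit_unique u x _ _ mu_ uy (ur x))].
have um x : uminus u x = l x.
  by apply: get_unique => [|y uy];
    [exact: ul|exact: (@left_limit_unique u x _ _ mu_ uy (ul x))].
have rl x : r x - l x = atom p x - atom n x by rewrite /r /V /l; lra.
rewrite esum_mkcond; apply: eq_esum => x _.
rewrite up um rl real_normK ?num_real//; case: ifPn => // /negP xJ.
have -> : atom p x - atom n x = 0; last by rewrite expr0n.
rewrite -rl; apply/eqP; rewrite subr_eq0; apply/negP => /negP/eqP rlx; apply: xJ.
by apply: mem_set; exists (r x), (l x); split.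
Qed.

End jumps.

(** * The convolution as a potential of the derivative *)

Section potential.
Context {R : realType}.
Local Notation mu := (@lebesgue_measure R).
Local Notation fmeasure := {finite_measure set (measurableTypeR R) -> \bar R}.
Implicit Types (a : fmeasure) (x y r : R).

Lemma cdf_le a x y : x <= y -> cdf a x <= cdf a y.
Proof.
move=> xy; rewrite /cdf fine_le ?fin_num_measure//.
apply: le_measure; rewrite ?inE//; apply: subset_itvl.
by rewrite bnd_simp.
Qed.

Lemma measurable_cdf a : measurable_fun [set: R] (cdf a).
Proof. by apply: nondecreasing_measurable => // x y; exact: cdf_le. Qed.

Lemma cdf_bounded a x : `|cdf a x| <= fine (a setT).
Proof.
rewrite /cdf ger0_norm ?fine_ge0// fine_le ?fin_num_measure//.
by apply: le_measure; rewrite ?inE.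
Qed.

(** The convolution of g(./r) with the measure [a]. The factor 1/r of a dilation is absent because
    integrating [dilation f r] over a half-line consumes it. *)
Definition potential (g : R -> R) a r x : R :=
  Rintegral a setT (fun t => g ((x - t) / r)).

Variable f : R -> R.
Hypotheses (if0 : mu.-integrable setT (EFin \o f))
  (f0 : Rintegral mu setT f = 0).
Local Notation F := (antiderivative f).

Let mf : measurable_fun [set: R] f.
Proof. by apply/measurable_EFinP; exact: measurable_int if0. Qed.

Lemma dilation_affine r x y : dilation f r (x - y) = r^-1 * f (- r^-1 * y + x / r).
Proof. by rewrite /dilation; congr (_ * f _); ring. Qed.

Lemma integrable_dilation r x : 0 < r ->
  mu.-integrable setT (EFin \o (fun y => dilation f r (x - y))).
Proof.
move=> r0; rewrite (_ : EFin \o _ = EFin \o (fun y => r^-1 * f (- r^-1 * y + x / r))).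
  apply: integrable_scale; apply: (integrable_affine _ _ if0).
  by rewrite oppr_eq0 invr_eq0 gt_eqF.
by apply/funext => y /=; rewrite dilation_affine.
Qed.

Lemma Rintegral_dilation r x : 0 < r ->
  Rintegral mu setT (fun y => dilation f r (x - y)) = 0.
Proof.
move=> r0; have r1 : - r^-1 != 0 by rewrite oppr_eq0 invr_eq0 gt_eqF.
under eq_Rintegral do rewrite dilation_affine.
rewrite RintegralZl//; last exact: (integrable_affine _ r1 if0).
have := Rintegral_affine (x / r) r1 if0.
by rewrite f0 normrN gtr0_norm ?invr_gt0.
Qed.

(** The substitution s = (x - y)/r turns y >= t into s <= (x - t)/r, and its Jacobian cancels the
    factor 1/r. *)
Lemma dilation_half_line r x t : 0 < r ->
  Rintegral mu setT (fun y => dilation f r (x - y) * (if t <= y then 1 else 0)) =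
  F ((x - t) / r).
Proof.
move=> r0; have r1 : - r^-1 != 0 by rewrite oppr_eq0 invr_eq0 gt_eqF.
have ih := integrable_half_line if0 ((x - t) / r).
rewrite /antiderivative (Rintegral_affine (x / r) r1 ih).
rewrite -RintegralZl//; last exact: (integrable_affine _ r1 ih).
apply: eq_Rintegral => y _; rewrite normrN gtr0_norm ?invr_gt0//.
rewrite dilation_affine mulrAC -mulrA; congr (_ * (_ * _)).
rewrite (_ : - r^-1 * y + x / r = (x - y) / r); last by ring.
by rewrite ler_pM2r ?invr_gt0// lerD2l lerN2.
Qed.

(** [cdf a y] is the [a]-integral over t of the indicator of t <= y. Exchanging the integrals leaves
    the dilation integrated over [t, +oo[; joint integrability holds because [a] is finite. *)
Lemma convolution_cdf a r x : 0 < r ->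
  Rintegral mu setT (fun y => dilation f r (x - y) * cdf a y) = potential F a r x.
Proof.
move=> r0; have idil := integrable_dilation x r0.
pose k (p : R * R) : R := dilation f r (x - p.1) * (if p.2 <= p.1 then 1 else 0).
have kle p : `|k p| <= `|dilation f r (x - p.1)|.
  by rewrite /k; case: ifP; rewrite ?mulr1// mulr0 normr0.
have mdil : measurable_fun [set: R] (fun y => dilation f r (x - y)).
  by apply/measurable_EFinP; exact: measurable_int idil.
have mind : measurable_fun setT (fun p : R * R => if p.2 <= p.1 then 1 else 0 : R).
  by apply: measurable_fun_ifT => //; exact: measurable_fun_ler.
have mk : measurable_fun setT k.
  by apply: measurable_funM => //; exact: (measurableT_comp mdil).
have ik : (mu \x a)%E.-integrable setT (EFin \o k).
  apply/integrable12ltyP => //=; first exact/measurable_EFinP.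
  have idn := integrable_scale (fine (a setT)) (integrable_norm idil).
  move/integrableP : (idn) => [_]; apply: le_lt_trans.
  apply: ge0_le_integral => //=.
  - by move=> y _; exact: integral_ge0.
  - apply: (@measurable_fun_fubini_tonelli_F _ _ _ _ R a (fun p => `|k p|%:E)) => //.
    by apply/measurable_EFinP; exact: measurableT_comp.
  - by apply/measurable_EFinP; apply: measurableT_comp => //; apply/measurable_EFinP;
    exact: measurable_int idn.
  move=> y _.
  apply: (@le_trans _ _ (\int[a]_t (cst `|dilation f r (x - y)|%:E) t)%E).
    apply: ge0_le_integral => //=.
      by apply/measurable_EFinP; apply: measurableT_comp => //;
        exact: (measurableT_comp mk (pair1_measurable y)).
    by move=> t _; rewrite lee_fin; exact: (kle (y, t)).
  rewrite integral_cst//= [in leRHS]ger0_norm ?mulr_ge0 ?fine_ge0//.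
  by rewrite EFinM muleC fineK// fin_num_measure.
have k1 y : measurable_fun [set: R] (fun t => k (y, t)).
  exact: (measurableT_comp mk (pair1_measurable y)).
have k2 t : measurable_fun [set: R] (fun y => k (y, t)).
  exact: (measurableT_comp mk (pair2_measurable t)).
have ik1 y : a.-integrable setT (EFin \o (fun t => k (y, t))).
  apply: (@finite_integrable _ _ _ a _ `|dilation f r (x - y)|); first exact: k1.
  by move=> t; exact: (kle (y, t)).
have ik2 t : mu.-integrable setT (EFin \o (fun y => k (y, t))).
  apply: (@integrable_of_le _ _ _ mu _ (fun y => `|dilation f r (x - y)|)).
  - exact: k2.
  - by move=> y; exact: (kle (y, t)).
  - exact: integrable_norm.
have [_ _ E] := Rintegral_fubini ik ik1 ik2.
transitivity (Rintegral mu setT (fun y => Rintegral a setT (fun t => k (y, t)))).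
  apply: eq_Rintegral => y _; rewrite /k/= RintegralZl//; last first.
    apply: (@finite_integrable _ _ _ _ _ 1).
      exact: (measurableT_comp mind (pair1_measurable y)).
    by move=> t; case: ifP; rewrite ?normr1 ?normr0.
  rewrite cdfE; congr (_ * _); apply: eq_Rintegral => t _.
  by rewrite mem_setE in_itv/=; case: ifP.
by rewrite E; apply: eq_Rintegral => t _; exact: dilation_half_line.
Qed.

Lemma convolution_BV (p n : fmeasure) (u : R -> R) (k r x : R) : 0 < r ->
  measurable_fun setT u ->
  {ae mu, forall y, u y = k + (cdf p y - cdf n y)} ->
  convolution (dilation f r) u x = potential F p r x - potential F n r x.
Proof.
move=> r0 mu_ uV; have idil := integrable_dilation x r0.
have mdil : measurable_fun [set: R] (fun y => dilation f r (x - y)).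
  by apply/measurable_EFinP; exact: measurable_int idil.
have ic a : mu.-integrable setT (EFin \o (fun y => dilation f r (x - y) * cdf a y)).
  exact: (integrable_mul_bounded idil (measurable_cdf a) (cdf_bounded a)).
rewrite -!convolution_cdf// -RintegralB//.
transitivity (Rintegral mu setT (fun y => k * dilation f r (x - y) +
   (dilation f r (x - y) * cdf p y - dilation f r (x - y) * cdf n y))); last first.
  have i1 := integrable_scale k idil.
  have i2 := integrable_sub (ic p) (ic n).
  by rewrite [LHS]RintegralD// RintegralZl// Rintegral_dilation// mulr0 add0r.
congr fine; apply: ae_eq_integral => //.
- by apply/measurable_EFinP; exact: measurable_funM.
- apply/measurable_EFinP; apply: measurable_funD; first exact: measurable_funM.
  by apply: measurable_funB; apply: measurable_funM => //; exact: measurable_cdf.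
- move: uV; apply: filterS; first exact: (ae_filter_ringOfSetsType mu).
  by move=> y uy _; rewrite uy; congr EFin; ring.
Qed.

End potential.

(** * Atoms of finite measures *)

Section atoms.
Context {R : realType}.
Local Open Scope ereal_scope.

(** m distinct atoms of mass at least e have total mass at least m e, which forces m <= b(R)/e; an
    infinite set would contain a finite subset too large for this. *)
Lemma finite_big_atoms (b : {finite_measure set (measurableTypeR R) ->
  \bar R}) (e : R) :
  (0 < e)%R -> finite_set [set y : R | e%:E <= b [set y]].
Proof.
move=> e0; apply: contrapT => infA.
have bT : b setT \is a fin_num by exact: fin_num_measure.
have [B BA BN] := infinite_set_fset (Num.truncn (fine (b setT) / e)).+1 infA.
have sumB (s : seq R) : (forall x, x \in s -> e%:E <= b [set x]) ->
    (e * (size s)%:R)%:E <= \sum_(x <- s) b [set x].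
  elim: s => [|x s ih] h; first by rewrite big_nil mulr0.
  rewrite big_cons /= -natr1 mulrDr mulr1 addrC EFinD leeD ?h ?mem_head//.
  by apply: ih => y ys; apply: h; rewrite in_cons ys orbT.
have : (e * (#|` B|)%:R)%:E <= b setT.
  apply: (@le_trans _ _ (b (\bigcup_(x in [set` B]) [set x] : set
    (measurableTypeR R)))); last first.
    by apply: le_measure => //; apply: mem_set => //; apply: fin_bigcup_measurable.
  rewrite measure_fin_bigcup//; last by move=> x y _ _ [z []] /= <- <-.
  by rewrite -fsbig_seq//; apply: sumB => x xB; exact: BA.
apply/negP; rewrite -ltNge -(fineK bT) lte_fin mulrC -ltr_pdivrMr//.
by rewrite (lt_le_trans (truncnS_gt _))// ler_nat.
Qed.

Lemma countable_atoms (b : {finite_measure set (measurableTypeR R) -> \bar R}) :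
  countable [set y : R | b [set y] != 0].
Proof.
rewrite (_ : [set y | _] = \bigcup_n [set y | (n.+1%:R^-1)%:E <= b [set y]]).
  by apply: bigcup_countable => // n _; apply/finite_set_countable/finite_big_atoms.
apply/seteqP; split=> [y/= by0|y [n _ /=]]; last first.
  by apply: contraTneq => ->; rewrite lee_fin -ltNge.
have fb : b [set y] \is a fin_num by exact: fin_num_measure.
have b0 : (0 < fine (b
  [set y]))%R by rewrite fine_gt0// lt0e by0 measure_ge0 ltey_eq fb.
exists (Num.truncn (fine (b [set y]))^-1) => //=.
rewrite -(fineK fb) lee_fin invf_ple ?posrE//.
exact/ltW/truncnS_gt.
Qed.

(** b{y} is the [b]-measure of the section at y of the diagonal, a measurable subset of the
    plane. *)
Lemma measurable_atoms (b : {finite_measure set (measurableTypeR R) -> \bar R}) :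
  measurable_fun setT (fun y : R => b [set y]).
Proof.
have mD : measurable [set p : R * R | p.1 == p.2].
  rewrite -[X in measurable X]setTI.
  by apply: (measurable_fun_eqr _ _ measurableT (Y := [set true])).
rewrite (_ : (fun y => _) = b \o xsection [set p : R * R | p.1 == p.2]).
  exact: measurable_fun_xsection.
apply/funext => y /=; congr (b _); apply/seteqP; split=> z; rewrite xsectionE /=.
  by move=> ->.
by move/eqP.
Qed.

(** The integrand vanishes off the countable set K of atoms of [b]. An injection of K into the
    naturals cuts it into a sequence of pieces with at most one point each, and countable additivity
    applies. *)
Lemma integral_atoms (a b : {finite_measure set (measurableTypeR R) -> \bar R}) :
  \int[a]_y b [set y] = \esum_(y in [set: R]) (a [set y] * b [set y]).
Proof.
pose K := [set y : R | b [set y] != 0].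
have [f finj] := countable_injP _ (countable_atoms b).
pose F n := K `&` f @^-1` [set n].
have KF : K = \bigcup_n F n.
  by apply/seteqP; split=> [y Ky|y [n _ []]//]; exists (f y).
have Fsub n x y : F n x -> F n y -> x = y.
  move=> [Kx /= fx] [Ky /= fy].
  by apply: finj; [exact: mem_set|exact: mem_set|rewrite fx fy].
have F01 n : F n = set0 \/ exists x, F n = [set x].
  have [->|/set0P[x Fx]] := eqVneq (F n) set0; [by left|right].
  by exists x; apply/seteqP; split=> [y Fy|y ->//]; exact: (Fsub n).
have mF n : measurable (F n : set (measurableTypeR R)).
  by case: (F01 n) => [->|[x ->]].
have tF : trivIset setT F.
  by move=> i j _ _ [x [[_ /= <-] [_ /= <-]]].
transitivity (\int[a]_(y in K) b [set y]).
  rewrite [RHS]integral_mkcond; apply: eq_integral => y _; rewrite patchE.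
  by case: ifPn => //; rewrite notin_setE /K/= => /negP/negPn/eqP.
transitivity (\esum_(y in K) (a [set y] * b [set y])); last first.
  rewrite esum_mkcond; apply: eq_esum => y _.
  by case: ifPn => //; rewrite notin_setE /K/= => /negP/negPn/eqP ->; rewrite mule0.
rewrite KF ge0_integral_bigcup//; last first.
  by apply: measurable_funTS; exact: measurable_atoms.
rewrite nneseries_sum_bigcup//; last by move=> x; rewrite mule_ge0.
apply: eq_eseriesr => n _.
case: (F01 n) => [->|[x ->]]; first by rewrite integral_set0 esum_set0.
rewrite esum_set1 ?mule_ge0//.
rewrite (eq_integral (cst (b [set x]))); last by move=> y /set_mem ->.
by rewrite integral_cst// muleC.
Qed.

End atoms.

(** * The blow-up limit *)

Section atom_sums.
Context {R : realType}.
Local Notation fmeasure := {finite_measure set (measurableTypeR R) -> \bar R}.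
Implicit Types a b p q : fmeasure.

Lemma EFin_atom b (x : R) : (atom b x)%:E = b [set x].
Proof. by rewrite /atom fineK// fin_num_measure. Qed.

Lemma measurable_atom b : measurable_fun [set: R] (atom b).
Proof.
apply/measurable_EFinP; rewrite (_ : EFin \o _ = fun y => b [set y]).
  exact: measurable_atoms.
by apply/funext => y; rewrite /= EFin_atom.
Qed.

Lemma integrable_atom a b : a.-integrable setT (EFin \o atom b).
Proof.
apply: (@finite_integrable _ _ _ a _ (fine (b setT))); first exact: measurable_atom.
move=> x; rewrite /atom ger0_norm ?fine_ge0// fine_le ?fin_num_measure//.
by apply: le_measure; rewrite ?inE.
Qed.

Lemma Rintegral_atom a b : (Rintegral a setT (atom b))%:E =
  \esum_(x in [set: R]) (atom a x * atom b x)%:E.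
Proof.
rewrite /Rintegral fineK;
  last exact: (integrable_fin_num measurableT (integrable_atom a b)).
under eq_integral do rewrite EFin_atom.
by rewrite integral_atoms; apply: eq_esum => x _; rewrite EFinM !EFin_atom.
Qed.

(** Each mixed integral is the sum of [atom p x * atom q x], hence 0; for the same reason the square
    on the right has no cross term. *)
Lemma esum_square_atoms p q : (forall x : R, atom p x * atom q x = 0) ->
  ((Rintegral p setT (atom p) - Rintegral p setT (atom q)) -
   (Rintegral q setT (atom p) - Rintegral q setT (atom q)))%:E =
  \esum_(x in [set: R]) ((atom p x - atom q x) ^+ 2)%:E.
Proof.
move=> pq0.
have zero a b : (forall x : R, atom a x * atom b x = 0) ->
  Rintegral a setT (atom b) = 0.
  by move=> ab0; apply: EFin_inj; rewrite Rintegral_atom esum1// => x _; rewrite ab0.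
rewrite (zero p q)// (zero q p); last by move=> x; rewrite mulrC.
rewrite subr0 sub0r opprK EFinD !Rintegral_atom -esumD.
- apply: eq_esum => x _; rewrite -EFinD; congr EFin.
  by rewrite sqrrB pq0 mul0rn subr0 !expr2.
- by move=> x _; rewrite lee_fin -expr2 sqr_ge0.
- by move=> x _; rewrite lee_fin -expr2 sqr_ge0.
Qed.

(** P and N are disjoint, so every point misses one of them, and the corresponding Jordan part does
    not charge it. *)
Lemma jordan_atoms (nu : {charge set (measurableTypeR R) -> \bar R})
    (P N : set (measurableTypeR R)) (nuPN : hahn_decomposition nu P N) (x : R) :
  atom (jordan_pos nuPN) x * atom (jordan_neg nuPN) x = 0.
Proof.
have [_ _ _ PN0] := nuPN.
have mx : measurable ([set x] : set (measurableTypeR R)) by [].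
change (fine (jordan_pos nuPN [set x]) * fine (jordan_neg nuPN [set x]) = 0).
rewrite jordan_posE cjordan_posE jordan_negE cjordan_negE /crestr0 mem_set//.
rewrite /crestr; have [xP|xP] := pselect (P x).
  have -> : [set x] `&` N = set0.
    apply/seteqP; split=> // y [/= -> xN].
    by have : (P `&` N) x by []; rewrite PN0.
  by rewrite charge0 oppe0 mulr0.
have -> : [set x] `&` P = set0 by apply/seteqP; split=> // y [/= ->].
by rewrite charge0 mul0r.
Qed.

End atom_sums.

Section blow_up.
Context {R : realType}.
Local Notation mu := (@lebesgue_measure R).
Local Notation fmeasure := {finite_measure set (measurableTypeR R) -> \bar R}.
Implicit Types (a : fmeasure) (w : R -> R) (x y z r t : R).

Variables (F : R -> R) (M D : R).
Hypotheses (iF : mu.-integrable setT (EFin \o F)) (FM : forall x, `|F x| <= M)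
  (FD : forall x, `|x| * `|F x| <= D).

Let mF : measurable_fun [set: R] F.
Proof. by apply/measurable_EFinP; exact: measurable_int iF. Qed.

Let M0 : 0 <= M.
Proof. exact: le_trans (FM 0). Qed.

Let msub r : measurable_fun setT (fun p : R * R => (p.1 - p.2) / r).
Proof. by apply: measurable_funM => //; exact: measurable_funB. Qed.

Let mFsub r : measurable_fun setT (fun p : R * R => F ((p.1 - p.2) / r)).
Proof. exact: (measurableT_comp mF (msub r)). Qed.

Let mFsub1 r x : measurable_fun [set: R] (fun t => F ((x - t) / r)).
Proof. exact: (measurableT_comp (mFsub r) (pair1_measurable x)). Qed.

Let mFsub2 r t : measurable_fun [set: R] (fun x => F ((x - t) / r)).
Proof. exact: (measurableT_comp (mFsub r) (pair2_measurable t)). Qed.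

Lemma integrable_shifted r t : 0 < r ->
  mu.-integrable setT (EFin \o (fun x => F ((x - t) / r))).
Proof.
move=> r0; rewrite (_ : EFin \o _ = EFin \o (fun x => F (r^-1 * x + - (t / r)))).
  by apply: (integrable_affine _ _ iF); rewrite invr_eq0 gt_eqF.
by apply/funext => x /=; congr (F _)%:E; ring.
Qed.

(** Integrated in x first, |F((x - t)/r)| gives r times the integral of |F|, independent of t, and
    [a] is finite. *)
Lemma integrable_kernel a r : 0 < r ->
  (mu \x a)%E.-integrable setT (EFin \o (fun p : R * R => F ((p.1 - p.2) / r))).
Proof.
move=> r0; apply/integrable21ltyP => //=; first by apply/measurable_EFinP; exact: mFsub.
have e t : (\int[mu]_x `|(F ((x - t) / r))%:E| = r%:E * \int[mu]_z `|(F z)%:E|)%E.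
  have mabs : measurable_fun [set: R] (fun x => `|(F ((x - t) / r))%:E|%E).
    by apply/measurable_EFinP; apply: measurableT_comp => //; exact: mFsub2.
  have r1 : r != 0 by rewrite gt_eqF.
  rewrite (ge0_integral_affine t r1 mabs) ?gtr0_norm//; congr (_ * _)%E.
  by apply: eq_integral => z _; rewrite addrK mulrC mulKf// gt_eqF.
under eq_integral do rewrite e.
have fI : (\int[mu]_z `|(F z)%:E|)%E \is a fin_num.
  exact: (integrable_fin_num measurableT (integrable_abse iF)).
have fa : a setT \is a fin_num by exact: fin_num_measure.
by rewrite integral_cst//= -(fineK fI) -(fineK fa) -!EFinM ltry.
Qed.

Lemma potential_bounded a r x : `|potential F a r x| <= M * fine (a setT).
Proof.
have ix : a.-integrable setT (EFin \o (fun t => F ((x - t) / r))).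
  by apply: (@finite_integrable _ _ _ a _ M); [exact: mFsub1|move=> t; exact: FM].
apply: (le_trans (le_normr_Rintegral measurableT ix)).
rewrite -(@Rintegral_cst _ _ _ a setT measurableT M).
apply: le_Rintegral => //; first exact: integrable_norm.
exact: finite_measure_integrable_cst.
Qed.

Lemma integrable_potential a r : 0 < r ->
  mu.-integrable setT (EFin \o potential F a r).
Proof.
move=> r0.
have [] // := Rintegral_fubini (integrable_kernel a r0) _ _.
- move=> x; apply: (@finite_integrable _ _ _ a _ M); first exact: mFsub1.
  by move=> t; exact: FM.
- by move=> t; exact: integrable_shifted.
Qed.

Lemma measurable_potential a r : 0 < r -> measurable_fun [set: R] (potential F a r).
Proof. by move=> r0; apply/measurable_EFinP;
  exact: measurable_int (integrable_potential a r0). Qed.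

(** The function w seen at scale r around t, tested against [F]. *)
Definition blow_up w r t : R := Rintegral mu setT (fun z => w (r * z + t) * F z).

Lemma integrable_blow_up w (W : R) r t : measurable_fun [set: R] w ->
  (forall x, `|w x| <= W) ->
  mu.-integrable setT (EFin \o (fun z => w (r * z + t) * F z)).
Proof.
move=> mw wW; apply: (@integrable_of_le _ _ _ mu _ (fun z => W * `|F z|)).
- by apply: measurable_funM => //; apply: (measurableT_comp mw);
  exact: measurable_affine.
- by move=> z; rewrite normrM ler_wpM2r.
- by apply: integrable_scale; exact: integrable_norm.
Qed.

Lemma blow_up_bounded w (W : R) r t : measurable_fun [set: R] w ->
  (forall x, `|w x| <= W) ->
  `|blow_up w r t| <= W * Rintegral mu setT (fun z => `|F z|).
Proof.
move=> mw wW; have iwF := integrable_blow_up r t mw wW.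
apply: (le_trans (le_normr_Rintegral measurableT iwF)).
rewrite -RintegralZl//; last exact: integrable_norm.
apply: le_Rintegral => //.
- exact: integrable_norm.
- by apply: integrable_scale; exact: integrable_norm.
- by move=> z _; rewrite normrM ler_wpM2r.
Qed.

(** Fubini, then x = r z + t in the inner integral. The Jacobian r is what the normalisation 1/r of
    the squared norm cancels. Measurability of the blow-up in t is a by-product of Fubini. *)
Lemma potential_pairing a w (W : R) r : 0 < r -> measurable_fun [set: R] w ->
  (forall x, `|w x| <= W) ->
  measurable_fun [set: R] (blow_up w r) /\
  Rintegral mu setT (fun x => w x * potential F a r x) =
  r * Rintegral a setT (blow_up w r).
Proof.
move=> r0 mw wW.
pose k (p : R * R) : R := w p.1 * F ((p.1 - p.2) / r).
have kle p : `|k p| <= W * `|F ((p.1 - p.2) / r)|.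
  by rewrite normrM ler_wpM2r.
have mk : measurable_fun setT k.
  by apply: measurable_funM => //; exact: (measurableT_comp mw).
have k1 x : measurable_fun [set: R] (fun t => k (x, t)).
  exact: (measurableT_comp mk (pair1_measurable x)).
have k2 t : measurable_fun [set: R] (fun x => k (x, t)).
  exact: (measurableT_comp mk (pair2_measurable t)).
have ik : (mu \x a)%E.-integrable setT (EFin \o k).
  apply: (@integrable_of_le _ _ _ (mu \x a)%E _ (fun p => W * `|F ((p.1 - p.2) / r)|)).
  - exact: mk.
  - exact: kle.
  - by apply: integrable_scale; apply: integrable_norm; exact: integrable_kernel.
have W0 : 0 <= W by exact: le_trans (wW 0).
have ik1 x : a.-integrable setT (EFin \o (fun t => k (x, t))).
  apply: (@finite_integrable _ _ _ a _ (W * M)); first exact: k1.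
  by move=> t; apply: (le_trans (kle (x, t))); rewrite ler_wpM2l.
have ik2 t : mu.-integrable setT (EFin \o (fun x => k (x, t))).
  apply: (@integrable_of_le _ _ _ mu _ (fun x => W * `|F ((x - t) / r)|)).
  - exact: k2.
  - by move=> x; exact: (kle (x, t)).
  - by apply: integrable_scale; apply: integrable_norm; exact: integrable_shifted.
have [_ mK E] := Rintegral_fubini ik ik1 ik2.
have KE t : Rintegral mu setT (fun x => k (x, t)) = r * blow_up w r t.
  have r1 : r != 0 by rewrite gt_eqF.
  rewrite (Rintegral_affine t r1 (ik2 t)) gtr0_norm//; congr (_ * _).
  by apply: eq_Rintegral => z _; rewrite /k/= addrK [r * z / r]mulrC mulKf// gt_eqF.
have bE : blow_up w r = fun t => r^-1 * Rintegral mu setT (fun x => k (x, t)).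
  by apply/funext => t; rewrite KE mulKf// gt_eqF.
split.
  by rewrite bE; exact: measurable_funM.
transitivity (Rintegral mu setT (fun x => Rintegral a setT (fun t => k (x, t)))).
  apply: eq_Rintegral => x _; rewrite /k/= RintegralZl//.
  by apply: (@finite_integrable _ _ _ a _ M); [exact: mFsub1|move=> t; exact: FM].
rewrite E.
have ib : a.-integrable setT (EFin \o blow_up w r).
  apply: (@finite_integrable _ _ _ a _ (W * Rintegral mu setT (fun z => `|F z|))).
    by rewrite bE; exact: measurable_funM.
  by move=> t; exact: blow_up_bounded.
rewrite -RintegralZl//; apply: eq_Rintegral => t _.
by rewrite KE.
Qed.

Definition signed_potential
  (p q : fmeasure) r x : R := potential F p r x - potential F q r x.

Definition energy : R := Rintegral mu setT (fun z => F z * F z).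

Section limit.
Variable s : R^nat.
Hypotheses (s_gt0 : forall n, 0 < s n) (s_cvg : s n @[n --> \oo] --> 0).

(** The integrand at y is F(z + (t - y)/s_n). For y = t it is constantly F(z); for y != t the decay
    of [F] bounds it by D s_n / |s_n z + (t - y)|, which tends to 0. The constant M dominates, as
    [a] is finite. *)
Lemma potential_cvg a z t :
  potential F a (s n) (s n * z + t) @[n --> \oo] --> atom a t * F z.
Proof.
have -> : atom a t * F z = Rintegral a setT (fun y => F z * \1_([set t]) y).
  rewrite RintegralZl//; last by apply: integrable_indic => //;
    rewrite ltey_eq fin_num_measure.
  by rewrite /Rintegral integral_indic// setIT mulrC.
rewrite /potential; apply: (dominated_Rintegral (G := cst M) _ _ _ _).2.
- by move=> n; exact: mFsub1.
- move=> y; rewrite indicE; have [/set_mem ->|yt] := boolP (y \in [set t]).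
    apply: cvg_near_cst; apply: nearW => n.
    by rewrite addrK [s n * z]mulrC mulfK ?mulr1// gt_eqF.
  have {}yt : t - y != 0.
    by apply: contra yt => /eqP h; apply: mem_set => /=; lra.
  rewrite mulr0; apply: norm_cvg0.
  have den : s n * z + (t - y) @[n --> \oo] --> t - y.
    rewrite -[X in _ --> X]add0r -[X in _ --> X + _](mul0r z).
    by apply: cvgD; [apply: cvgMl|exact: cvg_cst].
  have up : D * s n * `|s n * z + (t - y)|^-1 @[n --> \oo] --> (0 : R).
    rewrite -(mul0r (`|t - y|^-1)); apply: cvgM.
      by rewrite -[X in _ --> X](mulr0 D); apply: cvgMr.
    by apply: cvgV; [rewrite normr_eq0|exact: cvg_norm].
  apply: (squeeze_cvgr _ (cvg_cst 0) up).
  near=> n; rewrite normr_ge0/=.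
  (* The denominator tends to t - y != 0, so it is nonzero for large n only. *)
  have dn0 : s n * z + (t - y) != 0.
    near: n; have /cvgrPdist_lt/(_ `|t - y|) := den.
    rewrite normr_gt0 => /(_ yt); apply: filterS => n h.
    by apply: contraTneq h => ->; rewrite subr0 ltxx.
  rewrite ler_pdivlMr ?normr_gt0//.
  have := FD ((s n * z + t - y) / s n).
  rewrite normrM normfV (gtr0_norm (s_gt0 n)) addrA mulrAC.
  by rewrite ler_pdivrMr// mulrC.
- exact: finite_measure_integrable_cst.
- by move=> n y; exact: FM.
Unshelve. all: by end_near. Qed.

Variables (p q : fmeasure).
Local Notation w := (fun n => signed_potential p q (s n)).
Local Notation W := (M * fine (p setT) + M * fine (q setT)).

Let mw n : measurable_fun [set: R] (w n).
Proof. by apply: measurable_funB; exact: measurable_potential. Qed.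

Let wW n x : `|w n x| <= W.
Proof. by rewrite (le_trans (ler_normB _ _))// lerD// potential_bounded. Qed.

Let iFF : mu.-integrable setT (EFin \o (fun z => F z * F z)).
Proof. exact: (integrable_mul_bounded iF mF FM). Qed.

(** w_n(s_n z + t) tends to F(z) times the difference of the atoms at t; testing against [F]
    produces the second factor F(z), hence the constant [energy]. This holds for every t, as it must
    before integrating against a measure with atoms. *)
Lemma blow_up_cvg t :
  blow_up (w n) (s n) t @[n --> \oo] --> energy * (atom p t - atom q t).
Proof.
have -> : energy * (atom p t - atom q t) =
    Rintegral mu setT (fun z => (atom p t - atom q t) * (F z * F z)).
  by rewrite RintegralZl// mulrC.
rewrite /blow_up; apply: (@dominated_Rintegral _ _ _ mu (fun n z =>
  w n (s n * z + t) * F z)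
  _ (fun z => W * `|F z|) _ _ _ _).2.
- move=> n; apply/measurable_EFinP.
  exact: measurable_int (integrable_blow_up (s n) t (mw n) (wW n)).
- move=> z; rewrite mulrA; apply: cvgMl; rewrite mulrBl.
  by apply: cvgB; exact: potential_cvg.
- by apply: integrable_scale; exact: integrable_norm.
- by move=> n z; rewrite normrM ler_wpM2r.
Qed.

Lemma pairing_cvg a :
  (s n)^-1 * Rintegral mu setT (fun x => w n x * potential F a (s n) x) @[n --> \oo]
  --> energy * (Rintegral a setT (atom p) - Rintegral a setT (atom q)).
Proof.
have ia b : a.-integrable setT (EFin \o atom b) by exact: integrable_atom.
have -> : energy * (Rintegral a setT (atom p) - Rintegral a setT (atom q)) =
    Rintegral a setT (fun t => energy * (atom p t - atom q t)).
  rewrite RintegralZl//; last exact: (integrable_sub (ia p) (ia q)).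
  by rewrite (RintegralB measurableT (ia p) (ia q)).
under eq_fun do rewrite (potential_pairing a (s_gt0 _) (mw _) (wW _)).2 mulKf ?gt_eqF//.
apply: (dominated_Rintegral (G := cst (W * Rintegral mu setT (fun z =>
  `|F z|))) _ _ _ _).2.
- by move=> n; exact: (potential_pairing a (s_gt0 _) (mw _) (wW _)).1.
- exact: blow_up_cvg.
- exact: finite_measure_integrable_cst.
- by move=> n t; exact: blow_up_bounded.
Qed.

(** One factor of the square is expanded as the potential of [p] minus that of [q], and
    [pairing_cvg] is applied to each. *)
Lemma energy_cvg :
  (s n)^-1 * Rintegral mu setT (fun x => w n x ^+ 2) @[n --> \oo] -->
  energy * ((Rintegral p setT (atom p) - Rintegral p setT (atom q)) -
            (Rintegral q setT (atom p) - Rintegral q setT (atom q))).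
Proof.
have iw a n : mu.-integrable setT (EFin \o (fun x => w n x * potential F a (s n) x)).
  rewrite (_ : (fun x => _) = fun x => potential F a (s n) x * w n x).
    exact: (integrable_mul_bounded (integrable_potential a (s_gt0 n)) (mw n) (wW n)).
  by apply/funext => x; rewrite mulrC.
rewrite (_ : (fun n => _) = fun n =>
  (s n)^-1 * Rintegral mu setT (fun x => w n x * potential F p (s n) x) -
  (s n)^-1 * Rintegral mu setT (fun x => w n x * potential F q (s n) x)).
  by rewrite mulrBr; apply: cvgB; exact: pairing_cvg.
apply/funext => n; rewrite -mulrBr -RintegralB//; congr (_ * _).
by apply: eq_Rintegral => x _; rewrite -mulrBr expr2.
Qed.

Lemma integrable_square n : mu.-integrable setT (EFin \o (fun x => w n x ^+ 2)).
Proof.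
have i : mu.-integrable setT (EFin \o w n).
  by apply: integrable_sub; exact: integrable_potential.
exact: (integrable_mul_bounded i (mw n) (wW n)).
Qed.

End limit.
End blow_up.

(** * The theorem *)

Lemma sqr_Lnorm2 (R : realType) (w : R -> R) :
  (@lebesgue_measure R).-integrable setT (EFin \o (fun x => w x ^+ 2)) ->
  ('N[@lebesgue_measure R]_(2%:E)[EFin \o w] ^+ 2)%E =
  (Rintegral (@lebesgue_measure R) setT (fun x => w x ^+ 2))%:E.
Proof.
move=> iw; rewrite unlock /=.
under eq_integral do rewrite powR_mulrn// real_normK ?num_real//.
rewrite /Rintegral; set I := (\int[_]_x _)%E.
have fI : I \is a fin_num by exact: (integrable_fin_num measurableT iw).
have I0 : (0 <= I)%E by apply: integral_ge0 => x _; rewrite lee_fin sqr_ge0.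
rewrite -(fineK fI) poweR_EFin -EFinM -expr2; congr EFin.
by rewrite powR12_sqrt ?fine_ge0// sqr_sqrtr ?fine_ge0.
Qed.

Theorem theorem5p2 (R : realType) (f : R -> R)
    (f_smooth : smooth f)
    (f_moment : lebesgue_measure.-integrable setT (fun x : R => (`|x| * f x)%:E))
    (f_mean0 : (\int[lebesgue_measure]_x (f x)%:E = 0)%E) :
  exists c : R, forall u : R -> R, BV_line u ->
    ((r^-1)%:E *
       'N[lebesgue_measure]_(2%:E)[EFin \o convolution (dilation f r) u] ^+ 2)%E
      @[r --> 0^'+] -->
    (c%:E * \esum_(x in jump_set u) (`|uplus u x - uminus u x| ^+ 2)%:E)%E.
Proof.
have if0 := moment_integrable (smooth_continuous f_smooth) f_moment.
have f0 : Rintegral lebesgue_measure setT f = 0 by rewrite /Rintegral f_mean0.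
pose F := antiderivative f.
have iF := antiderivative_integrable if0 f_moment f0.
have FM := antiderivative_bounded if0.
have FD := antiderivative_decay if0 f_moment f0.
(* [F] is built from [f] alone, so the constant is fixed before [u] is introduced. *)
exists (energy F) => u [iu [nu du]].
have [P [N nuPN]] := Hahn_decomposition nu.
pose p : {finite_measure set (measurableTypeR R) -> \bar R} := jordan_pos nuPN.
pose n : {finite_measure set (measurableTypeR R) -> \bar R} := jordan_neg nuPN.
have [k uV] : exists k, {ae lebesgue_measure, forall y, u y = k + (cdf p y - cdf n y)}.
  exact: BV_representation.
have mu_ : measurable_fun setT u by apply/measurable_EFinP; exact: measurable_int iu.
rewrite (jump_sum mu_ uV) -esum_square_atoms; last exact: jordan_atoms.
rewrite -EFinM; apply/cvge_at_rightP => s [s_gt0 s_cvg].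
rewrite (_ : (fun m => _) = fun m => ((s m)^-1 *
    Rintegral lebesgue_measure setT (fun x => signed_potential F p n (s m) x ^+ 2))%:E).
  apply: cvg_EFin; first exact: nearW.
  exact: (energy_cvg iF FM FD s_gt0 s_cvg).
apply/funext => m.
rewrite (_ : convolution _ u = signed_potential F p n (s m)).
  by rewrite sqr_Lnorm2 ?EFinM//; exact: (integrable_square iF FM s_gt0).
apply/funext => x; rewrite /signed_potential.
exact: (convolution_BV if0 f0 x (s_gt0 m) mu_ uV).
Qed.
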